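(* Let $\mathfrak g=\mathfrak g_2$ over $\mathbb C$, let $\mathfrak n$ be its maximal nilpotent subalgebra, $H^k=H^k(\mathfrak n;\mathfrak n)$, and $\mathfrak l=\mathfrak l_\bullet=\Pi(H^{\bullet+1})$. Write $e_{pq}[r_1s_1,\dots,r_ks_k]$ for $e_{p,q}\otimes f^{r_1,s_1}\wedge\dots\wedge f^{r_k,s_k}$. A basis of $H^\bullet$ is given by the classes of the following cocycles. $H^0$: $h^0_1=e_{23}$. $H^1$: $h^1_1=2e_{01}[01]-3e_{10}[10]-e_{11}[11]+e_{12}[12]+3e_{13}[13]$; $h^1_2=e_{10}[10]+e_{11}[11]+e_{12}[12]+e_{13}[13]+2e_{23}[23]$; $h^1_3=e_{13}[10]$; $h^1_4=e_{23}[01]$. $H^2$: $h^2_1=-e_{01}[10,11]+e_{13}[10,23]$; $h^2_2=-68e_{01}[01,11]+216e_{10}[10,11]+74e_{11}[10,12]+39e_{12}[10,13]+31e_{12}[11,12]-9e_{13}[01,23]+108e_{13}[11,13]+9e_{23}[11,23]$; $h^2_3=-e_{01}[01,10]+e_{11}[10,11]+2e_{12}[10,12]+3e_{13}[10,13]+3e_{23}[10,23]$; $h^2_4=e_{13}[10,11]$; $h^2_5=e_{10}[01,13]$; $h^2_6=11e_{10}[01,11]+14e_{11}[01,12]+9e_{12}[01,13]+8e_{23}[12,13]$; $h^2_7=e_{10}[01,10]+e_{11}[01,11]+e_{12}[01,12]+e_{13}[01,13]+2e_{23}[01,23]$. $H^3$: $h^3_1=-18e_{01}[01,11,23]-9e_{01}[10,12,13]+60e_{10}[10,11,23]+21e_{11}[10,12,23]+10e_{12}[10,13,23]+12e_{12}[11,12,23]+30e_{13}[11,13,23]$;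 $h^3_2=13e_{01}[10,11,12]+6e_{12}[10,11,23]+9e_{13}[10,12,23]$; $h^3_3=e_{13}[10,11,23]$; $h^3_4=-217e_{01}[01,12,13]+124e_{10}[01,11,23]+62e_{10}[10,12,13]+183e_{11}[01,12,23]+28e_{11}[11,12,13]+126e_{12}[01,13,23]+127e_{23}[12,13,23]$; $h^3_5=-3e_{01}[01,10,11]-3e_{12}[10,11,12]+e_{13}[01,10,23]-5e_{13}[10,11,13]-4e_{23}[10,11,23]$; $h^3_6=e_{10}[01,12,13]$; $h^3_7=e_{10}[01,11,13]+2e_{11}[01,12,13]$; $h^3_8=28e_{10}[01,10,13]-3e_{10}[01,11,12]+19e_{11}[01,11,13]+19e_{12}[01,12,13]-37e_{23}[01,13,23]$. $H^4$: $h^4_1=e_{01}[10,11,12,23]$; $h^4_2=-4e_{01}[01,10,12,23]+35e_{01}[10,11,12,13]-31e_{11}[10,11,12,23]-18e_{12}[10,11,13,23]-27e_{13}[10,12,13,23]$; $h^4_3=e_{01}[01,10,11,23]+e_{12}[10,11,12,23]+2e_{13}[10,11,13,23]$; $h^4_4=e_{10}[01,12,13,23]$; $h^4_5=e_{10}[01,11,13,23]+2e_{11}[01,12,13,23]$; $h^4_6=11e_{01}[01,11,12,13]-4e_{10}[01,10,12,23]-4e_{10}[10,11,12,13]-7e_{11}[01,11,12,23]-9e_{12}[01,11,13,23]-5e_{13}[01,12,13,23]+e_{23}[11,12,13,23]$; $h^4_7=e_{10}[01,10,12,13]+e_{11}[01,11,12,13]+e_{23}[01,12,13,23]$. $H^5$: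 $h^5_1=e_{01}[10,11,12,13,23]$; $h^5_2=-e_{01}[01,11,12,13,23]+e_{10}[10,11,12,13,23]$; $h^5_3=e_{01}[01,10,11,12,23]-e_{13}[10,11,12,13,23]$; $h^5_4=e_{10}[01,11,12,13,23]$; $h^5_5=e_{10}[01,10,12,13,23]+e_{11}[01,11,12,13,23]$. $H^6$: $h^6_1=e_{01}[01,10,11,12,13,23]$; $h^6_2=e_{10}[01,10,11,12,13,23]$. Moreover, $\mathfrak l_\bullet$ is solvable, and the nonzero terms of its derived series $\mathfrak l_{(0)}=\mathfrak l$, $\mathfrak l_{(i+1)}=[\mathfrak l_{(i)},\mathfrak l_{(i)}]$ are $\mathfrak l_{(0)}=\mathfrak l$ and $$\mathfrak l_{(1)}=H^0\oplus\mathrm{Span}(h^1_3,h^1_4)\oplus H^2\oplus H^3\oplus H^4\oplus H^5\oplus H^6,$$ $$\mathfrak l_{(2)}=\mathrm{Span}(h^1_3,h^1_4,\ h^2_2,h^2_4,h^2_6,\ h^3_2,h^3_3,h^3_5,h^3_6,h^3_7,h^3_8,\ h^4_2,h^4_3,h^4_5,h^4_6,h^4_7,\ h^5_2,h^5_3,h^5_4,h^5_5,\ h^6_1,h^6_2),$$ $$\mathfrak l_{(3)}=\mathrm{Span}(h^2_4,h^6_2).$$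
   Context: The algebra $\mathfrak n$ is 6-dimensional with basis $e_{0,1},e_{1,0},e_{1,1},e_{1,2},e_{1,3},e_{2,3}$, where $e_{p,q}$ is the root vector (from a Chevalley basis) of the positive root with coordinates $(p,q)$ in the simple roots; $f^{p,q}$ is the dual basis of $\mathfrak n^*$. The nonzero brackets of basis vectors are (up to antisymmetry) $[e_{0,1},e_{1,0}]=e_{1,1}$, $[e_{0,1},e_{1,1}]=2e_{1,2}$, $[e_{0,1},e_{1,2}]=3e_{1,3}$, $[e_{1,0},e_{1,3}]=e_{2,3}$, $[e_{1,1},e_{1,2}]=-3e_{2,3}$. $C^k=\mathfrak n\otimes\Lambda^k\mathfrak n^*$ are the cochains with adjoint coefficients, with the Chevalley–Eilenberg differential; $H^k=H^k(\mathfrak n;\mathfrak n)$. Cocycles are identified with their classes. For monomials $a=e_\alpha\otimes f^{\beta_1}\wedge\dots\wedge f^{\beta_p}$, $b=e_{\alpha'}\otimes f^{\beta'_1}\wedge\dots\wedge f^{\beta'_q}$ put $$a\cdot b=\sum_{k=1}^{p}(-1)^{p-k}f^{\beta_k}(e_{\alpha'})\,e_\alpha\otimes f^{\beta_1}\wedge\dots\wedge\widehat{f^{\beta_k}}\wedge\dots\wedge f^{\beta_p}\wedge f^{\beta'_1}\wedge\dots\wedge f^{\beta'_q},$$ extended bilinearly, and $[a,b]=a\cdot b-(-1)^{(p-1)(q-1)}b\cdot a$. This makes $\Pi(C^{\bullet+1})$ ($\Pi$ is the change of parity; $C^{k+1}$ sits in degree $k$ with parity $k\bmod 2$) a differential graded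 Lie superalgebra and induces a Lie superalgebra structure on $\mathfrak l_\bullet$, $\mathfrak l_k=\Pi(H^{k+1})$. *)

(* Defs.v *)
From HB Require Import structures.
From mathcomp Require Import all_boot all_order all_algebra.
From mathcomp Require Import complex reals.

Set Implicit Arguments.
Unset Strict Implicit.
Unset Printing Implicit Defensive.

Import GRing.Theory.
Local Open Scope ring_scope.
Local Open Scope quotient_scope.

(* MathComp's quotient of an additive group by a subgroup, here by a subspace *)
(* W; the scaling and the finite-dimensional structure are added below.       *)
Notation quotv W := (Quotient.quot (pred_of_vspace W)).

Section QuotientSpace.
Variables (K : fieldType) (vT : vectType K) (W : {vspace vT}).

Lemma eq_piv (x y : vT) : (\pi_(quotv W) x == \pi_(quotv W) y) = (x - y \in W).
Proof. by rewrite Quotient.idealrBE. Qed.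

Lemma piv_is_additive : zmod_morphism \pi_(quotv W).
Proof. exact: pi_is_zmod_morphism. Qed.

Definition scaleqv (a : K) (q : quotv W) : quotv W :=
  \pi_(quotv W) (a *: repr q).

Lemma pivZ a x : \pi_(quotv W) (a *: x) = scaleqv a (\pi_(quotv W) x).
Proof.
by apply/eqP; rewrite eq_piv -scalerBr rpredZ // -eq_piv reprK eqxx.
Qed.

Lemma scaleqvA a b q : scaleqv a (scaleqv b q) = scaleqv (a * b) q.
Proof. by rewrite -[q]reprK -(pivZ b) -(pivZ a) -pivZ scalerA. Qed.

Lemma scale1qv : left_id 1 scaleqv.
Proof. by move=> q; rewrite -[q]reprK -pivZ scale1r. Qed.

Lemma pivB x y : \pi_(quotv W) (x - y) = \pi_(quotv W) x - \pi_(quotv W) y.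
Proof. exact: piv_is_additive. Qed.

Lemma piv0 : \pi_(quotv W) 0 = 0.
Proof. by rewrite -(subrr 0) pivB subrr. Qed.

Lemma pivD x y : \pi_(quotv W) (x + y) = \pi_(quotv W) x + \pi_(quotv W) y.
Proof. by rewrite -[y in LHS]opprK pivB -(sub0r y) pivB piv0 sub0r opprK. Qed.

Lemma scaleqvDr : right_distributive scaleqv +%R.
Proof.
by move=> a p q; rewrite -[p]reprK -[q]reprK -pivD -!pivZ -pivD scalerDr.
Qed.

Lemma scaleqvDl q : {morph scaleqv^~ q : a b / a + b}.
Proof. by move=> a b; rewrite -[q]reprK -!pivZ -pivD scalerDl. Qed.

HB.instance Definition _ := GRing.Zmodule_isLmodule.Build K (quotv W)
  scaleqvA scale1qv scaleqvDr scaleqvDl.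

Lemma piv_is_linear : linear \pi_(quotv W).
Proof. by move=> a x y; rewrite pivD pivZ. Qed.

Let p := daddv_pi W^C W.

Let pW x : x \in W -> p x = 0.
Proof.
move=> xW; have dW : (W :&: W^C = 0)%VS by rewrite capv_compl.
have xT : x \in (W + W^C)%VS by rewrite addv_complf memvf.
have := daddv_pi_add dW xT.
by rewrite daddv_pi_id // => /eqP; rewrite addrC -subr_eq0 addrK => /eqP.
Qed.

Lemma quotv_vect_iso : Vector.axiom (\dim W^C) (quotv W).
Proof.
pose X := vbasis W^C.
have dW : (W^C :&: W = 0)%VS by rewrite capvC capv_compl.
have freeX : free X by apply: basis_free (vbasisP _).
have Xp x : p x = \sum_i coord X i (p x) *: X`_i.
  by apply: coord_vbasis; rewrite memv_pi.
have pE x y : \pi_(quotv W) x = \pi_(quotv W) y -> p x = p y.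
  by move/eqP; rewrite eq_piv => /pW /eqP; rewrite linearB subr_eq0 => /eqP.
have pK x : \pi_(quotv W) (p x) = \pi_(quotv W) x.
  apply/eqP; rewrite eq_piv.
  have {2}<- : p x + daddv_pi W W^C x = x.
    by apply: daddv_pi_add; rewrite // addvC addv_complf memvf.
  by rewrite opprD addrA subrr sub0r rpredN memv_pi.
have prE x : p (repr (\pi_(quotv W) x)) = p x by apply: pE; rewrite reprK.
exists (fun q : quotv W => \row_i coord X i (p (repr q))).
  move=> a u v; rewrite -[u]reprK -[v]reprK -piv_is_linear !prE.
  by apply/rowP=> i; rewrite !mxE !linearP.
exists (fun r : 'rV_(\dim W^C) => \pi_(quotv W) (\sum_i r 0 i *: X`_i))
  => [q|r].
  rewrite -[RHS]reprK -[RHS]pK [in RHS]Xp; congr (\pi_(quotv W) _).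
  by apply: eq_bigr => i _; rewrite mxE.
apply/rowP=> i; rewrite mxE prE daddv_pi_id //; last first.
  apply: memv_suml => j _.
  by rewrite rpredZ // vbasis_mem // mem_nth ?size_tuple.
by rewrite coord_sum_free.
Qed.

HB.instance Definition _ := Lmodule_hasFinDim.Build K (quotv W) quotv_vect_iso.

HB.instance Definition _ := GRing.isScalable.Build K vT (quotv W) *:%R
  \pi_(quotv W) pivZ.

Definition piv : 'Hom(vT, quotv W) := linfun \pi_(quotv W).

Lemma pivE x : piv x = \pi_(quotv W) x.
Proof. by rewrite lfunE. Qed.

Lemma lker_piv : lker piv = W.
Proof.
apply/vspaceP=> x; rewrite memv_ker pivE -[x in RHS]subr0 -eq_piv.
by rewrite -pivE linear0.
Qed.

Lemma limg_piv : limg piv = fullv.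
Proof.
apply/vspaceP=> q; rewrite memvf -[q]reprK -pivE.
by rewrite memv_img ?memvf.
Qed.

End QuotientSpace.

(* The positive roots of G2, written in the coordinates of the simple roots;  *)
(* the order 01, 10, 11, 12, 13, 23 is the one in which exterior monomials    *)
(* are normalised.                                                            *)
Definition r01 : 'I_6 := @Ordinal 6 0 isT.
Definition r10 : 'I_6 := @Ordinal 6 1 isT.
Definition r11 : 'I_6 := @Ordinal 6 2 isT.
Definition r12 : 'I_6 := @Ordinal 6 3 isT.
Definition r13 : 'I_6 := @Ordinal 6 4 isT.
Definition r23 : 'I_6 := @Ordinal 6 5 isT.

Section Nilpotent.
Variable K : fieldType.

Local Notation n := 'rV[K]_6.

Definition e_ (a : 'I_6) : n := delta_mx 0 a.

Definition nbr_up (a b : 'I_6) : n :=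
  if (a, b) == (r01, r10) then e_ r11 else
  if (a, b) == (r01, r11) then 2 *: e_ r12 else
  if (a, b) == (r01, r12) then 3 *: e_ r13 else
  if (a, b) == (r10, r13) then e_ r23 else
  if (a, b) == (r11, r12) then - 3 *: e_ r23 else 0.

Definition nbr (x y : n) : n :=
  \sum_a \sum_b (x 0 a * y 0 b) *: (nbr_up a b - nbr_up b a).

End Nilpotent.

(* A cochain c in n (x) Lambda(n^* ) is given by the coefficients c S : n of  *)
(* the monomials f^{b_1} /\ ... /\ f^{b_k} with S = {b_1 < ... < b_k}; c S is *)
(* also the value of c, as an alternating map, at (e_{b_1}, ..., e_{b_k}).    *)
Notation cochain K := {ffun {set 'I_6} -> 'rV[K]_6}.

(* number of inversions *)
Fixpoint ninv (s : seq 'I_6) : nat :=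
  if s is x :: s' then (count (fun y : 'I_6 => (y < x)%N) s' + ninv s')%N
  else 0%N.

Definition delnth (i : nat) (s : seq 'I_6) : seq 'I_6 :=
  take i s ++ drop i.+1 s.

Section Cochains.
Variable K : fieldType.

(* e_a (x) f^{b_1} /\ ... /\ f^{b_k} for s = [:: b_1; ...; b_k] in any order; *)
(* it vanishes if s has repeated items                                        *)
Definition mono (a : 'I_6) (s : seq 'I_6) : cochain K :=
  [ffun S : {set 'I_6} =>
     if uniq s && ([set b in s] == S) then (-1) ^+ ninv s *: e_ K a else 0].

(* C^k *)
Definition Cdeg (k : nat) : {vspace cochain K} :=
  (\sum_(S : {set 'I_6} | #|S| == k) \sum_(a : 'I_6) <[mono a (enum S)]>)%VS.

(* the value c(e_{b_1}, ..., e_{b_k}) for s = [:: b_1; ...; b_k] *)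
Definition ceval (c : cochain K) (s : seq 'I_6) : 'rV[K]_6 :=
  if uniq s then (-1) ^+ ninv s *: c [set b in s] else 0.

(* The Chevalley-Eilenberg differential                                       *)
(*  (dc)(x_0, ..., x_k) = sum_i (-1)^i [x_i, c(.., ^x_i, ..)]                 *)
(*     + sum_(i < j) (-1)^(i + j) c([x_i, x_j], .., ^x_i, .., ^x_j, ..)       *)
(* at basis vectors x_0, ..., x_k listed in increasing order.                 *)
Definition ce (c : cochain K) : cochain K :=
  [ffun S : {set 'I_6} =>
     let s := enum S in
     let x i := e_ K (nth r01 s i) in
     \sum_(i < size s) (-1) ^+ i *: nbr (x i) (ceval c (delnth i s))
     + \sum_(i < size s) \sum_(j < size s | (i < j)%N)
         (-1) ^+ (i + j) *:
           \sum_b nbr (x i) (x j) 0 b *: ceval c (b :: delnth i (delnth j s))].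

Lemma nbr_linear (x : 'rV[K]_6) : linear (nbr x).
Proof.
move=> t y z; rewrite /nbr scaler_sumr -big_split; apply: eq_bigr => a _ /=.
rewrite scaler_sumr -big_split; apply: eq_bigr => b _ /=.
by rewrite !mxE mulrDr scalerDl !scalerA !mulrA [x 0 a * t]mulrC.
Qed.

Lemma ceval_linear (s : seq 'I_6) : linear (ceval^~ s).
Proof.
move=> t c c'; rewrite /ceval; case: ifP => _; last by rewrite scaler0 addr0.
by rewrite !ffunE scalerDr !scalerA [_ * t]mulrC.
Qed.

Lemma ce_linear : linear ce.
Proof.
move=> t c c'; apply/ffunP=> S; rewrite !ffunE /= scalerDr addrACA.
congr (_ + _).
  rewrite scaler_sumr -big_split; apply: eq_bigr => i _ /=.
  by rewrite ceval_linear nbr_linear scalerDr !scalerA [_ * t]mulrC.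
rewrite scaler_sumr -big_split; apply: eq_bigr => i _ /=.
rewrite scaler_sumr -big_split; apply: eq_bigr => j _ /=.
rewrite !scaler_sumr -big_split; apply: eq_bigr => b _ /=.
by rewrite ceval_linear !scalerDr !scalerA; rewrite mulrA [_ * t]mulrC mulrA.
Qed.

HB.instance Definition _ := GRing.isLinear.Build K (cochain K) (cochain K) _ ce
  ce_linear.

Definition dCE : 'End(cochain K) := linfun ce.

Definition cocycles (k : nat) : {vspace cochain K} := (lker dCE :&: Cdeg k)%VS.

(* a . b for a = e_a (x) f^{b_1} /\ ... /\ f^{b_p}, s = [:: b_1; ...; b_p]    *)
(* and b = e_a' (x) f^{b'_1} /\ ..., t = [:: b'_1; ...]; here k is 0-based    *)
Definition mdot (a : 'I_6) (s : seq 'I_6) (a' : 'I_6) (t : seq 'I_6)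
    : cochain K :=
  \sum_(k < size s)
    ((-1) ^+ (size s - k.+1) * (nth r01 s k == a')%:R)
      *: mono a (delnth k s ++ t).

(* [(p + 1) (q + 1)] has the parity of (p - 1) (q - 1), without truncation    *)
Definition mbr (a : 'I_6) (s : seq 'I_6) (a' : 'I_6) (t : seq 'I_6)
    : cochain K :=
  mdot a s a' t
  - (-1) ^+ ((size s).+1 * (size t).+1) *: mdot a' t a s.

Definition cbr (c c' : cochain K) : cochain K :=
  \sum_(S : {set 'I_6}) \sum_(a : 'I_6) \sum_(T : {set 'I_6}) \sum_(a' : 'I_6)
    (c S 0 a * c' T 0 a') *: mbr a (enum S) a' (enum T).

(* All cohomology classes live in the quotient of the space of cochains by    *)
(* the coboundaries, in which H^k is the image of the k-cocycles.             *)
Definition cohom : vectType K := quotv (limg dCE).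

Definition cls : 'Hom(cochain K, cohom) := piv (limg dCE).

Definition Hcoh (k : nat) : {vspace cohom} := (cls @: cocycles k)%VS.

(* H^(k+1) sits in degree k of l, so the sum over all k is the whole of l;    *)
(* the parities are accounted for by the signs in the bracket.                *)
Definition lalg : {vspace cohom} := (\sum_(k < 7) Hcoh k)%VS.

(* The induced bracket [cls z, cls z'] = cls [z, z'] of cohomology classes.   *)
(* Every representative of a class in [lalg] is a cocycle, and the brackets   *)
(* of a cocycle and a coboundary are coboundaries, so on [lalg] the choice of *)
(* representatives is immaterial; [cls^-1] is a linear one.                   *)
Definition Hbr (x y : cohom) : cohom :=
  cls (cbr ((cls^-1)%VF x) ((cls^-1)%VF y)).

Definition Hbrv (U W : {vspace cohom}) : {vspace cohom} :=
  <<[seq Hbr x y | x <- vbasis U, y <- vbasis W]>>%VS.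

Definition derived_series (i : nat) : {vspace cohom} :=
  iter i (fun L => Hbrv L L) lalg.

Lemma cbrDl c : linear (cbr^~ c).
Proof.
move=> t c1 c2; rewrite /cbr scaler_sumr -big_split; apply: eq_bigr => S _ /=.
rewrite scaler_sumr -big_split; apply: eq_bigr => a _ /=.
rewrite scaler_sumr -big_split; apply: eq_bigr => T _ /=.
rewrite scaler_sumr -big_split; apply: eq_bigr => a' _ /=.
by rewrite !ffunE !mxE scalerA -scalerDl mulrDl mulrA.
Qed.

Lemma cbrDr c : linear (cbr c).
Proof.
move=> t c1 c2; rewrite /cbr scaler_sumr -big_split; apply: eq_bigr => S _ /=.
rewrite scaler_sumr -big_split; apply: eq_bigr => a _ /=.
rewrite scaler_sumr -big_split; apply: eq_bigr => T _ /=.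
rewrite scaler_sumr -big_split; apply: eq_bigr => a' _ /=.
by rewrite !ffunE !mxE scalerA -scalerDl mulrDr mulrCA.
Qed.

Lemma Hbr_linear_l y : linear (Hbr^~ y).
Proof. by move=> t x1 x2; rewrite /Hbr linearP cbrDl linearP. Qed.

Lemma Hbr_linear_r x : linear (Hbr x).
Proof. by move=> t y1 y2; rewrite /Hbr linearP cbrDr linearP. Qed.

(* the brackets of basis vectors span all brackets *)
Lemma memv_Hbrv (U W : {vspace cohom}) x y :
  x \in U -> y \in W -> Hbr x y \in Hbrv U W.
Proof.
move=> /coord_vbasis -> /coord_vbasis ->.
pose fl z : {linear cohom -> cohom} := HB.pack (Hbr^~ z)
  (GRing.isLinear.Build _ _ _ _ _ (Hbr_linear_l z)).
pose fr z : {linear cohom -> cohom} := HB.pack (Hbr z)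
  (GRing.isLinear.Build _ _ _ _ _ (Hbr_linear_r z)).
rewrite -[Hbr _ _]/(fl _ _) linear_sum memv_suml // => i _.
rewrite linearZ rpredZ //= -[Hbr _ _]/(fr _ _) linear_sum memv_suml // => j _.
rewrite linearZ rpredZ //= memv_span //.
by apply: allpairs_f; rewrite mem_nth // size_tuple.
Qed.

Definition hs (k : nat) : seq (cochain K) :=
  match k with
  | 0%N =>
    [:: mono r23 [::]]
  | 1%N =>
    [:: 2 *: mono r01 [:: r01] - 3 *: mono r10 [:: r10] - mono r11 [:: r11]
        + mono r12 [:: r12] + 3 *: mono r13 [:: r13];
        mono r10 [:: r10] + mono r11 [:: r11] + mono r12 [:: r12]
        + mono r13 [:: r13] + 2 *: mono r23 [:: r23];
        mono r13 [:: r10];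
        mono r23 [:: r01]]
  | 2%N =>
    [:: - mono r01 [:: r10; r11] + mono r13 [:: r10; r23];
        - 68 *: mono r01 [:: r01; r11] + 216 *: mono r10 [:: r10; r11]
        + 74 *: mono r11 [:: r10; r12] + 39 *: mono r12 [:: r10; r13]
        + 31 *: mono r12 [:: r11; r12] - 9 *: mono r13 [:: r01; r23]
        + 108 *: mono r13 [:: r11; r13] + 9 *: mono r23 [:: r11; r23];
        - mono r01 [:: r01; r10] + mono r11 [:: r10; r11]
        + 2 *: mono r12 [:: r10; r12] + 3 *: mono r13 [:: r10; r13]
        + 3 *: mono r23 [:: r10; r23];
        mono r13 [:: r10; r11];
        mono r10 [:: r01; r13];
        11 *: mono r10 [:: r01; r11] + 14 *: mono r11 [:: r01; r12]
        + 9 *: mono r12 [:: r01; r13] + 8 *: mono r23 [:: r12; r13];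
        mono r10 [:: r01; r10] + mono r11 [:: r01; r11]
        + mono r12 [:: r01; r12] + mono r13 [:: r01; r13]
        + 2 *: mono r23 [:: r01; r23]]
  | 3%N =>
    [:: - 18 *: mono r01 [:: r01; r11; r23]
        - 9 *: mono r01 [:: r10; r12; r13]
        + 60 *: mono r10 [:: r10; r11; r23]
        + 21 *: mono r11 [:: r10; r12; r23]
        + 10 *: mono r12 [:: r10; r13; r23]
        + 12 *: mono r12 [:: r11; r12; r23]
        + 30 *: mono r13 [:: r11; r13; r23];
        13 *: mono r01 [:: r10; r11; r12] + 6 *: mono r12 [:: r10; r11; r23]
        + 9 *: mono r13 [:: r10; r12; r23];
        mono r13 [:: r10; r11; r23];
        - 217 *: mono r01 [:: r01; r12; r13]
        + 124 *: mono r10 [:: r01; r11; r23]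
        + 62 *: mono r10 [:: r10; r12; r13]
        + 183 *: mono r11 [:: r01; r12; r23]
        + 28 *: mono r11 [:: r11; r12; r13]
        + 126 *: mono r12 [:: r01; r13; r23]
        + 127 *: mono r23 [:: r12; r13; r23];
        - 3 *: mono r01 [:: r01; r10; r11]
        - 3 *: mono r12 [:: r10; r11; r12] + mono r13 [:: r01; r10; r23]
        - 5 *: mono r13 [:: r10; r11; r13]
        - 4 *: mono r23 [:: r10; r11; r23];
        mono r10 [:: r01; r12; r13];
        mono r10 [:: r01; r11; r13] + 2 *: mono r11 [:: r01; r12; r13];
        28 *: mono r10 [:: r01; r10; r13] - 3 *: mono r10 [:: r01; r11; r12]
        + 19 *: mono r11 [:: r01; r11; r13]
        + 19 *: mono r12 [:: r01; r12; r13]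
        - 37 *: mono r23 [:: r01; r13; r23]]
  | 4%N =>
    [:: mono r01 [:: r10; r11; r12; r23];
        - 4 *: mono r01 [:: r01; r10; r12; r23]
        + 35 *: mono r01 [:: r10; r11; r12; r13]
        - 31 *: mono r11 [:: r10; r11; r12; r23]
        - 18 *: mono r12 [:: r10; r11; r13; r23]
        - 27 *: mono r13 [:: r10; r12; r13; r23];
        mono r01 [:: r01; r10; r11; r23] + mono r12 [:: r10; r11; r12; r23]
        + 2 *: mono r13 [:: r10; r11; r13; r23];
        mono r10 [:: r01; r12; r13; r23];
        mono r10 [:: r01; r11; r13; r23]
        + 2 *: mono r11 [:: r01; r12; r13; r23];
        11 *: mono r01 [:: r01; r11; r12; r13]
        - 4 *: mono r10 [:: r01; r10; r12; r23]
        - 4 *: mono r10 [:: r10; r11; r12; r13]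
        - 7 *: mono r11 [:: r01; r11; r12; r23]
        - 9 *: mono r12 [:: r01; r11; r13; r23]
        - 5 *: mono r13 [:: r01; r12; r13; r23]
        + mono r23 [:: r11; r12; r13; r23];
        mono r10 [:: r01; r10; r12; r13] + mono r11 [:: r01; r11; r12; r13]
        + mono r23 [:: r01; r12; r13; r23]]
  | 5%N =>
    [:: mono r01 [:: r10; r11; r12; r13; r23];
        - mono r01 [:: r01; r11; r12; r13; r23]
        + mono r10 [:: r10; r11; r12; r13; r23];
        mono r01 [:: r01; r10; r11; r12; r23]
        - mono r13 [:: r10; r11; r12; r13; r23];
        mono r10 [:: r01; r11; r12; r13; r23];
        mono r10 [:: r01; r10; r12; r13; r23]
        + mono r11 [:: r01; r11; r12; r13; r23]]
  | 6%N =>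
    [:: mono r01 [:: r01; r10; r11; r12; r13; r23];
        mono r10 [:: r01; r10; r11; r12; r13; r23]]
  | _ => [::]
  end.

(* the class of h^k_i, with i starting at 1 *)
Definition hcls (k i : nat) : cohom := cls (nth 0 (hs k) i.-1).

Definition Span (I : seq (nat * nat)) : {vspace cohom} :=
  <<[seq hcls p.1 p.2 | p <- I]>>%VS.

End Cochains.

Arguments mono {K} a s.

(* Main.v *)
From Stdlib Require Import ZArith.
Require Import Defs.
From HB Require Import structures.
From mathcomp Require Import all_boot all_order all_algebra.
From mathcomp Require Import complex reals ssrZ.

Set Implicit Arguments.
Unset Strict Implicit.
Unset Printing Implicit Defensive.

Import GRing.Theory.
Local Open Scope ring_scope.
Local Open Scope complex_scope.

(** The cochains form a space of dimension 384 with the monomials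
e_a (x) f^s as a basis, and in that basis the differential and the bracket have
integer structure constants, so that every assertion is a statement about
sparse integer vectors.  It holds over every field of characteristic zero, and
that is how it is proved (cohomology_char0).

The differential is the bracket with one cochain, d = [mu, -], where mu is the
Lie bracket of n seen as a 2-cochain (dCE_mu).  The graded Jacobi identity for
mu, that is d[a, b] = [da, b] - (-1)^p [a, db] for a of degree p, is bilinear
in a and b, so it is enough to evaluate it on pairs of monomials (dCE_cbr).
Consequently the bracket of two classes is the class of the bracket of any two
cocycles that represent them (Hbr_cls), in particular of the listed ones.

For the cohomology, choose monomials, the pivots, whose differentials form a
basis of the coboundaries.  In each degree the listed cocycles h, the
differentials of the pivots and the pivots together span the cochains, and
altogether there are 384 of them; hence they form a basis of the cochains.  On
this basis d vanishes on h and on the differentials and is injective on the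
span of the pivots, so the classes of h are a basis of the cohomology
(family_full, size_family, Hcoh_span, free_cls).

Each step of the derived series then compares two subspaces spanned by explicit
vectors, the brackets of the given classes and the asserted generators, modulo
coboundaries (Hbrv_Span).  Memberships in a span are decided by fraction-free
Gaussian elimination over the integers; a successful reduction to zero proves
the membership over any field in which nonzero integers are invertible
(spanbP). *)

(** * Sparse cochains over the integers *)

(** Mon a m stands for e_a (x) f^s, where a is the position of a root in the
order 01, 10, 11, 12, 13, 23 and bit i of m says whether the root at position i
belongs to s. *)
Record monom := Mon { out : nat; legs : bitseq }.

(** A linear combination with integer coefficients.  The operations below never
produce a repeated monomial or a zero coefficient from vectors without them, so
a combination that vanishes is recognised as the empty list. *)
Definition vec := seq (monom * Z).

Definition vec1 (x : monom) : vec := [:: (x, Zpos xH)].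

(** The conditional keeps eager evaluation from comparing the bit masks of
monomials that already differ in their first component. *)
Definition eqmon (x y : monom) : bool :=
  if out x == out y then legs x == legs y else false.

Fixpoint add_monom (x : monom) (z : Z) (v : vec) : vec :=
  if v is (y, t) :: v' then
    if eqmon x y then
      let s := Z.add z t in if Z.eqb s 0 then v' else (x, s) :: v'
    else (y, t) :: add_monom x z v'
  else if Z.eqb z 0 then [::] else [:: (x, z)].

Definition add_scaled (c : Z) (u acc : vec) : vec :=
  foldr (fun t => add_monom t.1 (Z.mul c t.2)) acc u.

Fixpoint parity (m : bitseq) : bool :=
  if m is b :: m' then b (+) parity m' else false.

(** Removes f^a from the exterior monomial m.  The sign is the parity of the
number of factors to the right of f^a, which is the p - k of the formula for
a . b. *)
Fixpoint contract (a : nat) (m : bitseq) : option (bool * bitseq) :=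
  match m, a with
  | b :: m', 0%N => if b then Some (parity m', false :: m') else None
  | b :: m', a'.+1 =>
      if contract a' m' is Some (e, r) then Some (e, b :: r) else None
  | [::], _ => None
  end.

(** The exterior product of two increasing monomials.  Bits are read from the
smallest index upwards, and p is the parity of the number of factors of m2 met
so far: these are the factors that a factor of m1 at the current position has
to cross. *)
Fixpoint wedge (p : bool) (m1 m2 : bitseq) : option (bool * bitseq) :=
  match m1, m2 with
  | [::], [::] => Some (false, [::])
  | b1 :: m1', b2 :: m2' =>
      if b1 then
        if b2 then None else
        if wedge p m1' m2' is Some (e, r) then Some (p (+) e, true :: r)
        else None
      else if wedge (b2 (+) p) m1' m2' is Some (e, r) then Some (e, b2 :: r)
      else None
  | _, _ => None
  end.

Definition zsgn (e : bool) (z : Z) : Z := if e then Z.opp z else z.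

Definition dotmonom (x y : monom) : option (bool * monom) :=
  if contract (out y) (legs x) is Some (e1, m1) then
    if wedge false m1 (legs y) is Some (e2, m) then
      Some (e1 (+) e2, Mon (out x) m)
    else None
  else None.

Definition add_opt (o : option (bool * monom)) (z : Z) (acc : vec) : vec :=
  if o is Some (e, x) then add_monom x (zsgn e z) acc else acc.

(** Adds z [x, y] to acc.  In [a, b] = a . b - (-1)^((p-1)(q-1)) b . a the
second term has coefficient +1 exactly if p and q are both even. *)
Definition brmonom (x y : monom) (z : Z) (acc : vec) : vec :=
  add_opt (dotmonom x y) z
    (add_opt (dotmonom y x) (zsgn (parity (legs x) || parity (legs y)) z) acc).

Definition brvec (c : Z) (u v acc : vec) : vec :=
  foldr (fun t acc1 =>
    let z := Z.mul c t.2 in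
    foldr (fun t' => brmonom t.1 t'.1 (Z.mul z t'.2)) acc1 v) acc u.

Definition term (a : nat) (l : seq nat) (z : Z) : monom * Z :=
  (Mon a [seq i \in l | i <- iota 0 6], z).

(** The Lie bracket of n as an element of C^2. *)
Definition mu : vec :=
  [:: term 2 [:: 0; 1] 1; term 3 [:: 0; 2] 2; term 4 [:: 0; 3] 3;
      term 5 [:: 1; 4] 1; term 5 [:: 2; 3] (-3)]%N.

Definition dvec (u : vec) : vec := brvec 1 mu u [::].

Fixpoint allbits (n : nat) : seq bitseq :=
  if n is n'.+1 then
    let r := allbits n' in map (cons false) r ++ map (cons true) r
  else [:: [::]].

Definition mons : seq monom :=
  [seq Mon a m | a <- iota 0 6, m <- allbits 6].

Lemma eqmonP : Equality.axiom eqmon.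
Proof.
move=> [a m] [b r]; rewrite /eqmon /=.
case: eqP => [->|nab]; last by constructor=> -[].
by apply: (iffP eqP) => [->|[]].
Qed.

HB.instance Definition _ := hasDecEq.Build monom eqmonP.

(** * Index sets as bit masks *)

Lemma allbitsP n m : (m \in allbits n) = (size m == n).
Proof.
elim: n m => [|n IHn] [|b m] //=.
- by rewrite mem_cat; apply/negbTE/norP; split; apply/mapP=> -[].
rewrite mem_cat eqSS -IHn; case: b.
  rewrite orbC mem_map => [|? ? []//]; case: (m \in _) => //=.
  by apply/negbTE/mapP=> -[].
rewrite mem_map => [|? ? []//]; case: (m \in _) => //=.
by apply/negbTE/mapP=> -[].
Qed.

Definition roots : seq 'I_6 := [:: r01; r10; r11; r12; r13; r23].
Definition root (a : nat) : 'I_6 := nth r01 roots a.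
Definition supp (m : bitseq) : seq 'I_6 := mask m roots.

Lemma enum_roots : enum 'I_6 = roots.
Proof. by apply: (inj_map val_inj); rewrite val_enum_ord. Qed.

Lemma supp_uniq m : uniq (supp m).
Proof. by rewrite mask_uniq. Qed.

Lemma enum_supp m : enum [set b in supp m] = supp m.
Proof.
rewrite /enum_mem -enumT enum_roots [RHS]mask_filter //.
by apply: eq_filter => b; rewrite [LHS]inE.
Qed.

(** With enum_supp, this replaces sums over subsets of the roots by sums over
bit masks. *)
Lemma set_supp (S : {set 'I_6}) :
  exists2 m, size m == 6 & S = [set b in supp m].
Proof.
exists [seq b \in S | b <- roots]; first by rewrite size_map.
apply/setP=> b.
by rewrite inE /supp -filter_mask mem_filter -enum_roots mem_enum andbT.
Qed.

Lemma rootP (a : 'I_6) : root a = a.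
Proof. by apply: val_inj; case: a => [[|[|[|[|[|[|]]]]]] ?]. Qed.

Lemma root_inj : {in gtn 6 &, injective root}.
Proof. by move=> [|[|[|[|[|[|]]]]]] [|[|[|[|[|[|]]]]]]. Qed.

Lemma all_bits_rootP (P : nat -> bitseq -> bool) :
  all (fun a => all (P a) (allbits 6)) (iota 0 6) ->
  forall a m, (a < 6)%N -> size m = 6%N -> P a m.
Proof.
move=> /allP allPa a m lta szm.
have /allP : all (P a) (allbits 6) by apply: allPa; rewrite mem_iota.
by apply; rewrite allbitsP szm.
Qed.

Lemma all_bits2P (P : bitseq -> bitseq -> bool) :
  all (fun m => all (P m) (allbits 6)) (allbits 6) ->
  forall m m', size m = 6%N -> size m' = 6%N -> P m m'.
Proof.
move=> /allP allPm m m' szm szm'.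
have /allP : all (P m) (allbits 6) by apply: allPm; rewrite allbitsP szm.
by apply; rewrite allbitsP szm'.
Qed.

Lemma contractP a m : (a < 6)%N -> size m = 6%N ->
  let s := supp m in let k := index (root a) s in
  if contract a m is Some (e, r) then
    [&& root a \in s, delnth k s == supp r & odd (size s - k.+1) == e]
  else root a \notin s.
Proof.
move: a m; apply: (@all_bits_rootP (fun a m => let s := supp m in
  let k := index (root a) s in
  if contract a m is Some (e, r) then
    [&& root a \in s, delnth k s == supp r & odd (size s - k.+1) == e]
  else root a \notin s)).
by vm_compute.
Qed.

Lemma wedgeP m1 m2 : size m1 = 6%N -> size m2 = 6%N ->
  let s := supp m1 ++ supp m2 in
  if wedge false m1 m2 is Some (e, r) then
    [&& uniq s, perm_eq s (supp r) & odd (ninv s) == e]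
  else ~~ uniq s.
Proof.
move: m1 m2; apply: (@all_bits2P (fun m1 m2 => let s := supp m1 ++ supp m2 in
  if wedge false m1 m2 is Some (e, r) then
    [&& uniq s, perm_eq s (supp r) & odd (ninv s) == e]
  else ~~ uniq s)).
by vm_compute.
Qed.

Lemma size_contract a m e r :
  contract a m = Some (e, r) -> (a < size m)%N /\ size r = size m.
Proof.
elim: m a e r => [|b m IHm] [|a] //= e r; first by case: b => // -[_ <-].
case: contract (IHm a) => // -[e' r'] /(_ _ _ erefl)[lta szr] [_ <-] /=.
by rewrite ltnS szr.
Qed.

Lemma size_wedge p m1 m2 e r :
  wedge p m1 m2 = Some (e, r) -> size r = size m1 /\ size m1 = size m2.
Proof.
elim: m1 m2 p e r => [|b1 m1 IHm] [|b2 m2] //= p e r; first by case=> _ <-.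
case: b1; first case: b2 => //.
  case: wedge (IHm m2 p) => // -[e' r'] /(_ _ _ erefl)[sz1 sz2] [_ <-] /=.
  by rewrite sz1 sz2.
case: wedge (IHm m2 (b2 (+) p)) => // -[e' r'].
move=> /(_ _ _ erefl)[sz1 sz2] [_ <-] /=.
by rewrite sz1 sz2.
Qed.

Lemma ninv_supp m : size m = 6%N -> ninv (supp m) = 0%N.
Proof.
move=> szm; apply/eqP.
by apply: (@all_bits_rootP (fun _ m => ninv (supp m) == 0%N) _ 0%N).
Qed.

Lemma supp_parity m : size m = 6%N -> odd (size (supp m)) = parity m.
Proof.
move=> szm; apply/eqP.
by apply: (@all_bits_rootP
  (fun _ m => odd (size (supp m)) == parity m) _ 0%N).
Qed.

Lemma supp_inj m m' :
  size m = 6%N -> size m' = 6%N -> supp m =i supp m' -> m = m'.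
Proof.
have memK r : size r = 6%N -> r = [seq b \in supp r | b <- roots].
  move=> szr; apply/eqP.
  by apply: (@all_bits_rootP
    (fun _ r => r == [seq b \in supp r | b <- roots]) _ 0%N).
move=> szm szm' eqs; rewrite [LHS]memK // [RHS]memK //.
by apply: eq_map => b; apply: eqs.
Qed.

Lemma mem_mons a m : (Mon a m \in mons) = (a < 6)%N && (size m == 6).
Proof.
rewrite /mons; apply/allpairsP/andP => [[[b r] [bi rb [-> ->]]]|[lta szm]].
  by move: bi rb; rewrite mem_iota allbitsP.
by exists (a, m); rewrite mem_iota allbitsP.
Qed.

(** * From sparse vectors to cochains *)

Section Semantics.
Variable K : fieldType.

Definition ofZ (z : Z) : K := (int_of_Z z)%:~R.

Lemma ofZ1 : ofZ 1 = 1. Proof. by rewrite /ofZ mulr1z. Qed.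
Lemma ofZD x y : ofZ (Z.add x y) = ofZ x + ofZ y.
Proof. by rewrite /ofZ -intrD -[in RHS]rmorphD. Qed.
Lemma ofZM x y : ofZ (Z.mul x y) = ofZ x * ofZ y.
Proof. by rewrite /ofZ -intrM -[in RHS]rmorphM. Qed.
Lemma ofZN x : ofZ (Z.opp x) = - ofZ x.
Proof. by rewrite /ofZ -mulrNz -[in RHS]rmorphN. Qed.
Lemma ofZ_sgn e x : ofZ (zsgn e x) = (-1) ^+ e * ofZ x.
Proof. by case: e; rewrite /= ?ofZN ?mulN1r ?mul1r. Qed.

Definition valid (x : monom) : bool := (out x < 6)%N && (size (legs x) == 6).

(** Ill-formed monomials denote 0.  The operations on monomials never turn an
ill-formed argument into a well-formed result, so their relation to cochains
holds for all vectors. *)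
Definition monom_cochain (x : monom) : cochain K :=
  if valid x then mono (root (out x)) (supp (legs x)) else 0.

Definition vec_cochain (v : vec) : cochain K :=
  \sum_(t <- v) ofZ t.2 *: monom_cochain t.1.

Local Notation sem_monom := monom_cochain.
Local Notation sem := vec_cochain.

Lemma sem_monom_mono a m : (a < 6)%N -> size m = 6%N ->
  sem_monom (Mon a m) = mono (root a) (supp m).
Proof. by move=> lta szm; rewrite /monom_cochain /valid /= lta szm. Qed.

Lemma sem_nil : sem [::] = 0. Proof. exact: big_nil. Qed.

Lemma sem_cons t v : sem (t :: v) = ofZ t.2 *: sem_monom t.1 + sem v.
Proof. exact: big_cons. Qed.

Lemma sem1 x : sem (vec1 x) = sem_monom x.
Proof. by rewrite sem_cons sem_nil addr0 ofZ1 scale1r. Qed.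

Lemma sem_add_monom x z v :
  sem (add_monom x z v) = ofZ z *: sem_monom x + sem v.
Proof.
elim: v => [|[y t] v IHv] /=.
  case: Z.eqb_spec => [->|_]; last by rewrite sem_cons sem_nil.
  by rewrite sem_nil scale0r addr0.
case: eqmonP => [->|_]; last by rewrite !sem_cons IHv addrCA.
case: Z.eqb_spec => [zt0|_]; rewrite !sem_cons /= addrA -scalerDl -ofZD //.
by rewrite zt0 scale0r add0r.
Qed.

Lemma sem_add_scaled c u v : sem (add_scaled c u v) = ofZ c *: sem u + sem v.
Proof.
elim: u => [|t u IHu] /=; first by rewrite sem_nil scaler0 add0r.
by rewrite sem_add_monom IHu sem_cons scalerDr scalerA ofZM addrA.
Qed.

Definition sem_opt (o : option (bool * monom)) : cochain K :=
  if o is Some (e, x) then (-1) ^+ e *: sem_monom x else 0.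

Lemma sem_add_opt o z v : sem (add_opt o z v) = ofZ z *: sem_opt o + sem v.
Proof.
case: o => [[e x]|] /=; last by rewrite scaler0 add0r.
by rewrite sem_add_monom ofZ_sgn scalerA mulrC.
Qed.

Lemma mono_uniq0 a s : ~~ uniq s -> mono a s = 0 :> cochain K.
Proof. by move=> /negbTE nus; apply/ffunP=> S; rewrite !ffunE nus. Qed.

Lemma mono_perm a l s : uniq l -> perm_eq l s -> ninv s = 0%N ->
  mono a l = (-1) ^+ ninv l *: mono a s :> cochain K.
Proof.
move=> ul pls ns0; apply/ffunP=> S; rewrite !ffunE -(perm_uniq pls) ul ns0 /=.
have -> : [set b in l] = [set b in s].
  by apply/setP=> b; rewrite !inE (perm_mem pls).
by case: ifP => _; rewrite ?scaler0 // expr0 scale1r.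
Qed.

(** As s has no repetitions, a' can be contracted in one place only. *)
Lemma mdot_index a s a' t : uniq s -> a' \in s ->
  let k := index a' s in
  mdot K a s a' t = (-1) ^+ (size s - k.+1) *: mono a (delnth k s ++ t).
Proof.
move=> us a's k; have ltk : (k < size s)%N by rewrite index_mem.
rewrite /mdot (big_only1 (Ordinal ltk)) //= ?nth_index // ?eqxx ?mulr1 //.
move=> j; rewrite -val_eqE /= => njk _.
case: eqP => [sj|]; last by rewrite mulr0 scale0r.
by rewrite /k -sj index_uniq ?eqxx // in njk.
Qed.

Lemma mdot_notin a s a' t : a' \notin s -> mdot K a s a' t = 0.
Proof.
move=> a's; rewrite /mdot big1 // => k _; case: eqP => [sk|].
  by rewrite -sk mem_nth in a's.
by rewrite mulr0 scale0r.
Qed.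

Lemma signr_oddE n : (-1) ^+ n = (-1) ^+ odd n :> K.
Proof. by rewrite signr_odd. Qed.

(** For well-formed arguments, contractP and wedgeP identify the position and
the two signs in the sum that defines mdot.  For ill-formed ones the sizes of
the masks propagate to the result. *)
Lemma sem_opt_dotmonom x y : sem_opt (dotmonom x y) = if valid x && valid y then
  mdot K (root (out x)) (supp (legs x)) (root (out y)) (supp (legs y)) else 0.
Proof.
case: x y => [a m] [b r]; rewrite /valid /dotmonom /=.
have [okmr|nok] := boolP ((b < 6)%N && (size m == 6) && (size r == 6)).
  have /andP[/andP[ltb /eqP szm] /eqP szr] := okmr.
  rewrite ltb szm szr !eqxx !andbT.
  have := contractP ltb szm; case cbm: contract => [[e1 m1]|]; last first.
    by move=> bm; rewrite mdot_notin // if_same.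
  case/and3P=> bm /eqP dm /eqP e1E.
  have [_ szm1] := size_contract cbm; rewrite szm in szm1.
  rewrite mdot_index ?supp_uniq // dm signr_oddE e1E.
  have := wedgeP szm1 szr; case wmr: wedge => [[e2 m2]|]; last first.
    by move=> nu; rewrite mono_uniq0 // scaler0 if_same.
  have [szm2 _] := size_wedge wmr; rewrite szm1 in szm2.
  case/and3P=> us pms /eqP e2E.
  rewrite /= /monom_cochain /valid /= szm2 eqxx andbT.
  case: ifP => _; last by rewrite scaler0.
  rewrite (mono_perm _ us pms) ?ninv_supp // (signr_oddE (ninv _)) e2E.
  by rewrite scalerA -signr_addb.
rewrite (_ : _ && _ = false); last first.
  by apply: contraNF nok => /andP[/andP[_ ->] /andP[-> ->]].
case cbm: contract => [[e1 m1]|] //; have [ltb szm1] := size_contract cbm.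
case wmr: wedge => [[e2 m2]|] //=; have [szm2 szr] := size_wedge wmr.
rewrite /monom_cochain /valid /=.
case: ifP => [/andP[_ /eqP szm26]|]; last by rewrite scaler0.
move: nok; rewrite -szr -szm1 -szm2 szm26 eqxx !andbT.
by rewrite (leq_trans ltb) // -szm1 -szm2 szm26.
Qed.

Lemma mono_supp a m S b : size m = 6%N ->
  mono a (supp m) S 0 b = ((S == [set i in supp m]) && (b == a))%:R :> K.
Proof.
move=> szm; rewrite ffunE supp_uniq ninv_supp //= eq_sym.
by case: (S == _); rewrite /e_ !mxE ?eqxx ?mul1r.
Qed.

Lemma cbr_mono a m b r : size m = 6%N -> size r = 6%N ->
  cbr (mono a (supp m)) (mono b (supp r)) = mbr K a (supp m) b (supp r).
Proof.
move=> szm szr; rewrite /cbr.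
rewrite (big_only1 [set i in supp m]) //= => [|S nS _]; last first.
  apply: big1 => i _; apply: big1 => T _; apply: big1 => j _.
  by rewrite mono_supp // (negbTE nS) mul0r scale0r.
rewrite (big_only1 a) //= => [|i ni _]; last first.
  apply: big1 => T _; apply: big1 => j _.
  by rewrite mono_supp // (negbTE ni) andbF mul0r scale0r.
rewrite (big_only1 [set i in supp r]) //= => [|S nS _]; last first.
  apply: big1 => i _.
  by rewrite (mono_supp _ _ _ szr) (negbTE nS) mulr0 scale0r.
rewrite (big_only1 b) //= => [|i ni _]; last first.
  by rewrite (mono_supp _ _ _ szr) (negbTE ni) andbF mulr0 scale0r.
by rewrite !mono_supp // !eqxx mulr1 scale1r !enum_supp.
Qed.

Lemma cbr0l c : cbr 0 c = 0 :> cochain K.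
Proof. by have := cbrDl c (-1) 0 0; rewrite scaler0 addr0 scaleN1r addNr. Qed.
Lemma cbr0r c : cbr c 0 = 0 :> cochain K.
Proof. by have := cbrDr c (-1) 0 0; rewrite scaler0 addr0 scaleN1r addNr. Qed.

Lemma sem_brmonom x y z v :
  sem (brmonom x y z v) = ofZ z *: cbr (sem_monom x) (sem_monom y) + sem v.
Proof.
rewrite /brmonom !sem_add_opt !sem_opt_dotmonom ofZ_sgn addrA; congr (_ + _).
rewrite /monom_cochain [valid y && _]andbC.
case okx: (valid x); last by rewrite cbr0l !scaler0 addr0.
case oky: (valid y); last by rewrite cbr0r !scaler0 addr0.
have /andP[_ /eqP szx] := okx; have /andP[_ /eqP szy] := oky.
rewrite cbr_mono //= /mbr scalerBr; congr (_ + _).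
rewrite -scalerN -scaleNr mulrC -scalerA; congr (_ *: (_ *: _)).
rewrite [in RHS]signr_oddE oddM /= !supp_parity //.
by do 2!case: parity; rewrite /= ?expr0 ?opprK.
Qed.

Lemma sem_brvec c u v w :
  sem (brvec c u v w) = ofZ c *: cbr (sem u) (sem v) + sem w.
Proof.
elim: u => [|[x s] u IHu] /=; first by rewrite sem_nil cbr0l scaler0 add0r.
have -> acc :
    sem (foldr (fun t' => brmonom x t'.1 (Z.mul (Z.mul c s) t'.2)) acc v)
    = ofZ c *: (ofZ s *: cbr (sem_monom x) (sem v)) + sem acc.
  elim: v {IHu} => [|[y t] v IHv] /=.
    by rewrite sem_nil cbr0r !scaler0 add0r.
  by rewrite sem_brmonom IHv sem_cons cbrDr !ofZM !scalerDr !scalerA addrA.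
by rewrite IHu sem_cons cbrDl addrA -scalerDr.
Qed.

End Semantics.

(** * The differential as a bracket *)

Definition coef (v : vec) (y : monom) : Z :=
  foldr (fun t acc => if eqmon t.1 y then Z.add t.2 acc else acc) Z0 v.

Definition zsum (I : Type) (r : seq I) (F : I -> Z) : Z :=
  foldr (fun i => Z.add (F i)) Z0 r.

(** The thunk is evaluated for a nonzero n only; most structure constants of n
vanish, and this makes the evaluation of ce_coef affordable. *)
Definition lazy_mul (n : Z) (x : unit -> Z) : Z :=
  if Z.eqb n 0 then Z0 else Z.mul n (x tt).

(** The integer counterparts of nbr, ceval and ce, which compute the
coefficients of the differential of a monomial directly from its definition as
an alternating sum. *)
Definition nbr_up_coef (i j c : nat) : Z :=
  match i, j, c with
  | 0, 1, 2 => 1 | 0, 2, 3 => 2 | 0, 3, 4 => 3 | 1, 4, 5 => 1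
  | 2, 3, 5 => -3 | _, _, _ => 0
  end.

Definition nbr_coef (i j c : nat) : Z :=
  Z.add (nbr_up_coef i j c) (Z.opp (nbr_up_coef j i c)).

Definition ceval_coef (s l : seq 'I_6) : Z :=
  if size l == size s then
    if uniq l then if perm_eq l s then zsgn (odd (ninv l)) 1 else 0 else 0
  else 0.

Definition ce_coef (a : 'I_6) (s t : seq 'I_6) (b : 'I_6) : Z :=
  let x := nth r01 t in
  Z.add
    (zsum (iota 0 (size t)) (fun i => lazy_mul (nbr_coef (x i) a b)
      (fun _ => zsgn (odd i) (ceval_coef s (delnth i t)))))
    (if b == a then
       zsum (iota 0 (size t)) (fun i =>
         zsum [seq j <- iota 0 (size t) | (i < j)%N] (fun j =>
           zsum roots (fun c => lazy_mul (nbr_coef (x i) (x j) c)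
             (fun _ => zsgn (odd (i + j))
                         (ceval_coef s (c :: delnth i (delnth j t)))))))
     else 0).

(** d = [mu, -], coefficient by coefficient, on all monomials. *)
Definition ce_check : bool :=
  all (fun a => all (fun m =>
    let u := dvec (vec1 (Mon a m)) in
    all (fun b => all (fun r =>
      Z.eqb (ce_coef (root a) (supp m) (supp r) (root b)) (coef u (Mon b r)))
    (allbits 6)) (iota 0 6)) (allbits 6)) (iota 0 6).

Lemma ce_check_true : ce_check.
Proof. by vm_cast_no_check (erefl true). Qed.

Section Differential.
Variable K : fieldType.
Local Notation ofZ := (ofZ K).
Local Notation sem := (vec_cochain K).
Local Notation sem_monom := (monom_cochain K).

Lemma ofZ_sum (I : Type) (r : seq I) (F : I -> Z) :
  ofZ (zsum r F) = \sum_(i <- r) ofZ (F i).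
Proof.
by elim: r => [|i r IHr]; rewrite ?big_nil // big_cons -IHr -ofZD.
Qed.

Lemma ofZ_mul n x : ofZ (lazy_mul n x) = ofZ n * ofZ (x tt).
Proof. by rewrite /lazy_mul -ofZM; case: Z.eqb_spec => [->|]. Qed.

Lemma nbr_e (i j c : 'I_6) : nbr (e_ K i) (e_ K j) 0 c = ofZ (nbr_coef i j c).
Proof.
rewrite /nbr (big_only1 i) //= => [|a na _]; last first.
  by apply: big1 => b _; rewrite /e_ !mxE (negbTE na) andbF mul0r scale0r.
rewrite (big_only1 j) //= => [|a na _]; last first.
  by rewrite /e_ !mxE (negbTE na) andbF mulr0 scale0r.
rewrite /e_ !mxE !eqxx mulr1 mul1r /nbr_coef ofZD ofZN.
suff upE a b : nbr_up K a b 0 c = ofZ (nbr_up_coef a b c) by rewrite !upE.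
rewrite -(rootP a) -(rootP b) -(rootP c).
case: a => -[|[|[|[|[|[|]]]]]] // lta; case: b => -[|[|[|[|[|[|]]]]]] // ltb;
  rewrite /nbr_up /= ?mxE //; case: c => -[|[|[|[|[|[|]]]]]] // ltc;
  by rewrite ?mulr0 ?mulr1 ?mulr1n.
Qed.

Lemma ceval_mono a m l : size m = 6%N ->
  ceval (mono a (supp m)) l = ofZ (ceval_coef (supp m) l) *: e_ K a.
Proof.
move=> szm; rewrite /ceval /ceval_coef; case: ifP => [ul|]; last first.
  by rewrite if_same scale0r.
have -> : (if size l == size (supp m) then if perm_eq l (supp m) then
    zsgn (odd (ninv l)) 1 else Z0 else Z0) =
    if perm_eq l (supp m) then zsgn (odd (ninv l)) 1 else Z0.
  case: (boolP (perm_eq l _)) => [/perm_size->|_]; rewrite ?eqxx ?ul //.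
  by rewrite if_same.
rewrite ffunE supp_uniq ninv_supp //= scale1r.
have -> : ([set b in supp m] == [set b in l]) = perm_eq l (supp m).
  apply/eqP/idP => [eqs|/perm_mem eqs].
    rewrite uniq_perm ?supp_uniq // => b.
    by have /setP/(_ b) := eqs; rewrite !inE.
  by apply/setP=> b; rewrite !inE eqs.
case: ifP => _; last by rewrite scaler0 scale0r.
by rewrite ofZ_sgn -signr_oddE mulr1.
Qed.

Lemma ce_mono a m r b : size m = 6%N -> size r = 6%N ->
  ce (mono a (supp m)) [set i in supp r] 0 b
    = ofZ (ce_coef a (supp m) (supp r) b).
Proof.
move=> szm szr; rewrite ffunE enum_supp /ce_coef ofZD mxE; congr (_ + _).
  rewrite ofZ_sum summxE -[X in iota 0 X]subn0 big_mkord; apply: eq_bigr => i _.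
  rewrite ceval_mono // ofZ_mul ofZ_sgn -signr_oddE mxE.
  set y := nth _ _ _; rewrite -[_ *: e_ K a]addr0 nbr_linear.
  have -> : nbr (e_ K y) 0 = 0.
    have := nbr_linear (e_ K y) (-1) 0 0.
    by rewrite scaler0 addr0 scaleN1r addNr.
  by rewrite addr0 mxE nbr_e /= mulrA mulrC.
rewrite summxE; case: eqP => [->|nba]; last first.
  rewrite big1 // => i _; rewrite summxE big1 // => j _.
  rewrite mxE summxE big1 ?mulr0 // => c _.
  by rewrite ceval_mono // !mxE (negbTE (introN eqP nba)) andbF !mulr0.
rewrite ofZ_sum -[X in iota 0 X]subn0 big_mkord subn0; apply: eq_bigr => i _.
rewrite ofZ_sum big_filter -[X in iota 0 X]subn0 big_mkord summxE.
rewrite ?subn0; apply: eq_bigr => j _.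
rewrite mxE summxE ofZ_sum -enum_roots big_enum mulr_sumr.
apply: eq_bigr => c _; rewrite mxE nbr_e ceval_mono // ofZ_mul ofZ_sgn !mxE.
by rewrite !eqxx -signr_oddE mulr1 mulrCA.
Qed.

Lemma sem_monom_coef x b r : (b < 6)%N -> size r = 6%N ->
  sem_monom x [set i in supp r] 0 (root b) = (eqmon x (Mon b r))%:R.
Proof.
move=> ltb szr; case: x => a m; rewrite /monom_cochain /valid /=.
case: ifP => [/andP[lta /eqP szm]|nok]; last first.
  rewrite ffunE mxE; case: eqmonP => // -[ab mr].
  by rewrite ab mr ltb szr in nok.
rewrite mono_supp //; congr (_%:R); congr nat_of_bool.
apply/andP/eqmonP => [[/eqP/setP eqS /eqP ba]|[-> ->]]; last by rewrite !eqxx.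
congr Mon; first by apply: root_inj.
by apply: supp_inj => // c; have := eqS c; rewrite !inE.
Qed.

Lemma sem_coef v b r : (b < 6)%N -> size r = 6%N ->
  sem v [set i in supp r] 0 (root b) = ofZ (coef v (Mon b r)).
Proof.
move=> ltb szr; elim: v => [|[x z] v IHv]; first by rewrite sem_nil ffunE mxE.
rewrite sem_cons !(ffunE, mxE) IHv sem_monom_coef //=.
by case: ifP => _; rewrite ?ofZD ?mulr1 // mulr0 add0r.
Qed.

(** A property that is stable under linear combinations holds for all cochains
as soon as it holds for monomials. *)
Lemma cochain_ind (P : cochain K -> Prop) :
    P 0 -> (forall z u v, P u -> P v -> P (z *: u + v)) ->
    (forall a m, (a < 6)%N -> size m = 6%N -> P (mono (root a) (supp m))) ->
  forall c, P c.
Proof.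
move=> P0 PD Pm c.
have sumP (I : finType) (z : I -> K) (F : I -> cochain K) :
    (forall i, P (F i)) -> P (\sum_i z i *: F i).
  by move=> PF; elim/big_rec: _ => // i u _ Pu; apply: PD.
have -> : c = \sum_S \sum_a c S 0 a *: mono a (enum S).
  apply/ffunP=> T; rewrite sum_ffunE; apply/rowP=> b; rewrite summxE.
  have [m /eqP szm ->] := set_supp T.
  rewrite (big_only1 [set i in supp m]) //= => [|S nS _].
    rewrite sum_ffunE summxE (big_only1 b) //= => [|a na _].
      by rewrite ffunE mxE enum_supp mono_supp // !eqxx mulr1.
    rewrite ffunE mxE enum_supp mono_supp // (eq_sym b) (negbTE na) andbF.
    by rewrite mulr0.
  rewrite sum_ffunE summxE big1 // => a _; rewrite ffunE mxE.
  have [r /eqP szr defS] := set_supp S.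
  rewrite defS enum_supp mono_supp // -defS.
  by rewrite eq_sym (negbTE nS) mulr0.
rewrite -[X in P X](eq_bigr _ (fun S _ => scale1r _)).
apply: (sumP) => S; apply: (sumP) => a; have [m /eqP szm ->] := set_supp S.
by rewrite enum_supp -[a]rootP; apply: Pm.
Qed.

(** Both sides are linear in c and agree on monomials by evaluation. *)
Lemma dCE_mu c : dCE K c = cbr (sem mu) c.
Proof.
elim/cochain_ind: c => [|z u v IHu IHv|a m lta szm].
- by rewrite linear0 cbr0r.
- by rewrite linearP /= IHu IHv cbrDr.
rewrite lfunE; apply/ffunP=> S; apply/rowP=> b.
have [r /eqP szr ->] := set_supp S; rewrite -(rootP b) ce_mono //.
have -> : mono (root a) (supp m) = sem (vec1 (Mon a m)).
  by rewrite sem1 sem_monom_mono.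
have -> : cbr (sem mu) (sem (vec1 (Mon a m))) = sem (dvec (vec1 (Mon a m))).
  by rewrite sem_brvec sem_nil addr0 /ofZ mulr1z scale1r.
rewrite sem_coef //; congr ofZ; apply/Z.eqb_spec.
have := ce_check_true; rewrite /ce_check => /all_bits_rootP/(_ _ _ lta szm).
by move/all_bits_rootP; apply.
Qed.

End Differential.

(** * The bracket of cohomology classes *)

Definition dd_check : bool := all (fun x => nilp (dvec (dvec (vec1 x)))) mons.

Lemma dd_check_true : dd_check.
Proof. by vm_cast_no_check (erefl true). Qed.

(** [mu, [x, y]] - [[mu, x], y] + (-1)^p [x, [mu, y]] = 0 for all monomials x
and y, where p is the degree of x. *)
Definition leibniz_check : bool :=
  let L := [seq (x, dvec (vec1 x)) | x <- mons] in
  all (fun p => all (fun q =>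
    nilp (brvec 1 mu (brmonom p.1 q.1 1 [::])
           (brvec (-1) p.2 (vec1 q.1)
             (brvec (zsgn (parity (legs p.1)) 1) (vec1 p.1) q.2 [::])))) L)
    L.

Lemma leibniz_check_true : leibniz_check.
Proof. by vm_cast_no_check (erefl true). Qed.

Section Bracket.
Variable K : fieldType.
Local Notation sem := (vec_cochain K).
Local Notation sem_monom := (monom_cochain K).
Local Notation d := (dCE K).

Lemma sem_dvec u : sem (dvec u) = d (sem u).
Proof. by rewrite dCE_mu sem_brvec sem_nil addr0 ofZ1 scale1r. Qed.

Lemma cbrD_l (c x y : cochain K) : cbr (x + y) c = cbr x c + cbr y c.
Proof. by rewrite -[x]scale1r cbrDl !scale1r. Qed.

Lemma cbrD_r (c x y : cochain K) : cbr c (x + y) = cbr c x + cbr c y.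
Proof. by rewrite -[x]scale1r cbrDr !scale1r. Qed.

Lemma dCE_dCE c : d (d c) = 0.
Proof.
elim/cochain_ind: c => [|z u v IHu IHv|a m lta szm].
- by rewrite !linear0.
- by rewrite !linearP /= IHu IHv scaler0 addr0.
rewrite -sem_monom_mono // -sem1 -!sem_dvec.
have /allP/(_ (Mon a m)) := dd_check_true; rewrite mem_mons lta szm => /(_ isT).
by move/nilP->; rewrite sem_nil.
Qed.

Lemma mono_Cdeg a m : mono a (supp m) \in Cdeg K (size (supp m)).
Proof.
have eC : #|[set i in supp m]| == size (supp m) by rewrite cardE enum_supp.
apply: (subvP (sumv_sup [set i in supp m] eC (subvv _))).
rewrite enum_supp; apply: (subvP (sumv_sup a isT (subvv _))).
exact: memv_line.
Qed.

Lemma Cdeg_ind k (P : cochain K -> Prop) :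
    P 0 -> (forall z u v, P u -> P v -> P (z *: u + v)) ->
    (forall a m, (a < 6)%N -> size m = 6%N -> size (supp m) = k ->
       P (mono (root a) (supp m))) ->
  forall c, c \in Cdeg K k -> P c.
Proof.
move=> P0 PD Pm c /memv_sumP[u uP ->]; elim/big_rec: _ => // S x Sk Px.
rewrite -[u S]scale1r; apply: (PD) => //; have /memv_sumP[v vP ->] := uP S Sk.
elim/big_rec: _ => // a y _ Py; have /vlineP[z ->] := vP a isT.
apply: (PD) => //.
have [m /eqP szm defS] := set_supp S; rewrite defS enum_supp -[a]rootP.
by apply: Pm => //; rewrite -(eqP Sk) defS cardE enum_supp.
Qed.

(** The graded Jacobi identity for mu; by bilinearity it reduces to pairs of
monomials, where it is checked by evaluation. *)
Lemma dCE_cbr k c c' : c \in Cdeg K k ->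
  d (cbr c c') = cbr (d c) c' - (-1) ^+ k *: cbr c (d c').
Proof.
move=> cCk.
elim/Cdeg_ind: cCk c' => {c} => [c'|z u v IHu IHv c'|a m lta szm szk].
- by rewrite !(linear0, cbr0l) ?(scaler0, oppr0, addr0).
- rewrite cbrDl !linearP /= IHu IHv !cbrDl !scalerDr !scalerN !scalerA opprD.
  by rewrite mulrC addrACA.
elim/cochain_ind => [|z u v IHu IHv|b r ltb szr].
- by rewrite !(linear0, cbr0r) ?(scaler0, oppr0, addr0).
- rewrite cbrDr !linearP /= IHu IHv !cbrDr !scalerDr !scalerN !scalerA opprD.
  by rewrite mulrC addrACA.
rewrite -!sem_monom_mono //.
have /allP : leibniz_check by exact: leibniz_check_true.
move=> /(_ (Mon a m, dvec (vec1 (Mon a m)))).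
rewrite (map_f (fun x => (x, dvec (vec1 x)))) ?mem_mons ?lta ?szm //.
move=> /(_ isT).
move=> /allP/(_ (Mon b r, dvec (vec1 (Mon b r)))).
rewrite (map_f (fun x => (x, dvec (vec1 x)))) ?mem_mons ?ltb ?szr //.
move=> /(_ isT).
move=> /nilP/(congr1 sem); rewrite !sem_brvec sem_brmonom !sem_nil.
rewrite -!dCE_mu !sem1 ofZ_sgn (ofZN K 1) ofZ1 !scale1r !addr0 mulr1.
rewrite scaleN1r /= -supp_parity // szk -signr_oddE => /eqP.
by rewrite addr_eq0 opprD opprK => /eqP.
Qed.

Definition allcocycles : {vspace cochain K} := (\sum_(k < 7) cocycles K k)%VS.

Lemma allcocycles_ind (P : cochain K -> Prop) :
    P 0 -> (forall u v, P u -> P v -> P (u + v)) ->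
    (forall k c, c \in cocycles K k -> P c) ->
  forall c, c \in allcocycles -> P c.
Proof.
move=> P0 PD Pk c /memv_sumP[u uP ->]; elim/big_rec: _ => // i x _ Px.
by apply: (PD) => //; apply: Pk (uP i isT).
Qed.

Lemma cocycles_dCE k c : c \in cocycles K k -> d c = 0.
Proof. by rewrite memv_cap memv_ker => /andP[/eqP]. Qed.

Lemma allcocycles_dCE c : c \in allcocycles -> d c = 0.
Proof.
move=> cZ; elim/allcocycles_ind: cZ => [|u v du dv'|k u /cocycles_dCE//].
  exact: linear0.
by rewrite linearD /= du dv' addr0.
Qed.

(** When z is closed, the term with a sign depending on the degree of c drops
out of the Leibniz rule, which therefore extends linearly to all c. *)
Lemma cbr_dCE_l c z : d z = 0 -> cbr (d c) z = d (cbr c z).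
Proof.
move=> dz0; elim/cochain_ind: c => [|t u v IHu IHv|a m lta szm].
- by rewrite !(linear0, cbr0l).
- by rewrite cbrDl !linearP /= -IHu -IHv cbrDl.
by rewrite (dCE_cbr _ (mono_Cdeg _ _)) dz0 cbr0r scaler0 subr0.
Qed.

(** Here the sign depends on the degree of z, whence the decomposition of z into
homogeneous cocycles. *)
Lemma cbr_dCE_r z c : z \in allcocycles -> cbr z (d c) \in limg d.
Proof.
move=> zZ; elim/allcocycles_ind: zZ => [|u v IHu IHv|k u].
- by rewrite cbr0l mem0v.
- by rewrite cbrD_l memvD.
rewrite memv_cap memv_ker => /andP[/eqP du0 uk].
have /eqP := dCE_cbr c uk; rewrite du0 cbr0l sub0r -scaleNr => /eqP dE.
have -> : cbr u (d c) = d ((- (-1) ^+ k) *: cbr u c).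
  by rewrite linearZ /= dE scalerA mulrNN -expr2 sqrr_sign scale1r.
by rewrite memv_img ?memvf.
Qed.

Lemma eq_cls (x y : cochain K) : (cls K x == cls K y) = (x - y \in limg d).
Proof. by rewrite !pivE eq_piv. Qed.

(** The representatives chosen by Hbr have the form z + d b and z' + d b', and
[z + d b, z' + d b'] - [z, z'] = [z, d b'] + [d b, z' + d b'] is a
coboundary. *)
Lemma Hbr_cls z z' : z \in allcocycles -> z' \in allcocycles ->
  Hbr (cls K z) (cls K z') = cls K (cbr z z').
Proof.
move=> zZ z'Z; rewrite /Hbr.
have repr_cls c : exists b, (cls K)^-1%VF (cls K c) = c + d b.
  have /memv_imgP[b _ bE] : (cls K)^-1%VF (cls K c) - c \in limg d.
    by rewrite -eq_cls limg_lfunVK // memv_img ?memvf.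
  by exists b; rewrite -bE addrC subrK.
have [b ->] := repr_cls z; have [b' ->] := repr_cls z'.
apply/eqP; rewrite eq_cls cbrD_l cbrD_r.
rewrite addrAC [_ + _ - _]addrAC subrr add0r memvD ?cbr_dCE_r //.
rewrite cbr_dCE_l ?memv_img ?memvf //.
by rewrite linearD /= dCE_dCE addr0 allcocycles_dCE.
Qed.

End Bracket.

(** * Linear algebra of split complexes *)

Section SpanLemmas.
Variables (K : fieldType) (vT wT : vectType K).

Lemma span_ind (X : seq vT) (P : vT -> Prop) :
    P 0 -> (forall z u v, P u -> P v -> P (z *: u + v)) ->
    {in X, forall x, P x} -> forall v, v \in <<X>>%VS -> P v.
Proof.
move=> P0 PD PX v /(@coord_span _ _ _ (in_tuple X))->.
by elim/big_rec: _ => // i x _ Px; apply: PD => //; apply: PX; apply: mem_nth.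
Qed.

Lemma subseq_free (X Y : seq vT) : subseq X Y -> free Y -> free X.
Proof.
move=> XY freeY; have /(subseq_uniqP (free_uniq freeY)) -> := XY.
exact: filter_free.
Qed.

Lemma free_map_ker0 (f : 'Hom(vT, wT)) X u :
  free (map f X) -> u \in <<X>>%VS -> f u = 0 -> u = 0.
Proof.
rewrite /free size_map -limg_span => /eqP fX uX fu0; apply/eqP.
rewrite -memv0; suff /eqP <- : (<<X>> :&: lker f == 0)%VS.
  by rewrite memv_cap uX memv_ker fu0 eqxx.
rewrite -dimv_eq0 -(eqn_add2r (size X)) add0n -[X in (_ + X)%N]fX limg_ker_dim.
by rewrite eqn_leq dim_span -(limg_ker_dim f) fX leq_addl.
Qed.

End SpanLemmas.

(** A differential f on V and a spanning family H ++ f U ++ U with as many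
elements as the dimension of V, such that f vanishes on H.  The family is then
a basis, and in it f has its simplest possible form: it maps U bijectively onto
f U and the rest to 0. *)
Section SplitComplex.
Variables (K : fieldType) (V : vectType K) (f : 'End(V)) (H U : seq V).
Hypotheses (fH : {in H, forall x, f x = 0}) (ff : forall x, f (f x) = 0).
Hypothesis full : (<<H ++ map f U ++ U>> = fullv)%VS.
Hypothesis size_full : (size H + (size U).*2)%N = \dim {:V}.

Lemma split_free : free (H ++ map f U ++ U).
Proof. by rewrite /free full -size_full !size_cat size_map addnn. Qed.

Lemma split_limg : limg f = <<map f U>>%VS.
Proof.
apply: subv_anti; apply/andP; split; last by rewrite -limg_span limgS ?subvf.
rewrite -full limg_span !map_cat !span_cat !subv_add subvv andbT.
apply/andP; split; apply/span_subvP=> _ /mapP[x xX ->].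
  by rewrite fH ?mem0v.
by case/mapP: xX => y _ ->; rewrite ff mem0v.
Qed.

Lemma split_free_image : free (map f U).
Proof. by have := split_free; rewrite cat_free => /and3P[_ /catl_free]. Qed.

Lemma split_cap : (<<H>> :&: limg f = 0)%VS.
Proof.
have := split_free; rewrite catA => /catl_free.
by rewrite cat_free split_limg => /and3P[_ _ /directv_addP].
Qed.

Lemma split_free_classes : free H.
Proof. exact: catl_free split_free. Qed.

Lemma split_ker u : u \in <<U>>%VS -> f u = 0 -> u = 0.
Proof. exact: free_map_ker0 split_free_image. Qed.

End SplitComplex.

(** * Elimination over the integers *)

(** Cancels the leading monomial x of e in v by replacing v with a' v - b' e,
where a' and b' are the coefficients of x in e and v divided by their gcd.  If
a' is nonzero, the new vector lies in a subspace containing e if and only if v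
does.  Testing a' instead of reasoning about the gcd keeps the proof of this
fact elementary. *)
Definition eliminate (v e : vec) : vec :=
  if e is (x, a) :: _ then
    let b := coef v x in
    if Z.eqb b 0 then v else
    let g := Z.gcd a b in
    let a' := Z.div a g in
    if Z.eqb a' 0 then v
    else add_scaled a' v (add_scaled (Z.opp (Z.div b g)) e [::])
  else v.

Definition reduce (E : seq vec) (v : vec) : vec := foldl eliminate v E.

Definition echelon (r : seq vec) : seq vec :=
  foldl (fun E v => let u := reduce E v in if nilp u then E else rcons E u)
    [::] r.

Definition spanb (r vs : seq vec) : bool :=
  let E := echelon r in all (fun v => nilp (reduce E v)) vs.

Section Elimination.
Variable K : fieldType.
Hypothesis charK : [pchar K] =i pred0.
Local Notation sem := (vec_cochain K).

Lemma ofZ_eq0 z : (ofZ K z == 0) = Z.eqb z 0.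
Proof.
have /pcharf0P natK := charK.
rewrite /ofZ; case: z => [|p|p] /=; first by rewrite eqxx.
  by rewrite -pmulrn natK; apply/negbTE; case: (Pos2Nat.is_succ p) => n ->.
by rewrite NegzE mulrNz oppr_eq0 -pmulrn natK.
Qed.

Lemma mem_eliminate (W : {vspace cochain K}) v e :
  sem e \in W -> (sem (eliminate v e) \in W) = (sem v \in W).
Proof.
case: e => [|[x a] e] eW //; rewrite /eliminate.
case: ifP => // _; case: ifP => // na0.
rewrite !sem_add_scaled sem_nil addr0 rpredDr; last exact: rpredZ.
by rewrite rpredZeq ofZ_eq0 na0.
Qed.

Lemma mem_reduce (W : {vspace cochain K}) E v :
  {in E, forall e, sem e \in W} -> (sem (reduce E v) \in W) = (sem v \in W).
Proof.
elim: E v => [|e E IHE] v //= EW; rewrite IHE => [|u uE].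
  by rewrite mem_eliminate // EW ?mem_head.
by rewrite EW // in_cons uE orbT.
Qed.

Lemma mem_echelon (W : {vspace cochain K}) r :
  {in r, forall v, sem v \in W} -> {in echelon r, forall e, sem e \in W}.
Proof.
rewrite /echelon; have : {in [::] : seq vec, forall e, sem e \in W} by [].
elim: r [::] => [|v r IHr] E EW rW //=; apply: IHr => [e|u ur]; last first.
  by rewrite rW // in_cons ur orbT.
case: ifP => _; first exact: EW.
rewrite mem_rcons in_cons => /predU1P[->|]; last exact: EW.
by rewrite mem_reduce // rW ?mem_head.
Qed.

Lemma spanbP r vs : spanb r vs ->
  {in vs, forall v, sem v \in <<[seq sem u | u <- r]>>%VS}.
Proof.
move=> /allP spanr v /spanr/nilP redv.
rewrite -(mem_reduce _ (E := echelon r)); last first.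
  by apply: mem_echelon => u ur; rewrite memv_span ?map_f.
by rewrite redv sem_nil mem0v.
Qed.

End Elimination.

(** * The listed cocycles *)

(** The cocycles h^k_i in sparse form. *)
Definition hvec (k : nat) : seq vec :=
  match k with
  | 0 => [::
      [:: term 5 [::] 1]]
  | 1 => [::
      [:: term 0 [:: 0] 2; term 1 [:: 1] (-3); term 2 [:: 2] (-1);
         term 3 [:: 3] 1; term 4 [:: 4] 3];
      [:: term 1 [:: 1] 1; term 2 [:: 2] 1; term 3 [:: 3] 1; term 4 [:: 4] 1;
         term 5 [:: 5] 2];
      [:: term 4 [:: 1] 1];
      [:: term 5 [:: 0] 1]]
  | 2 => [::
      [:: term 0 [:: 1; 2] (-1); term 4 [:: 1; 5] 1];
      [:: term 0 [:: 0; 2] (-68); term 1 [:: 1; 2] 216; term 2 [:: 1; 3] 74;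
         term 3 [:: 1; 4] 39; term 3 [:: 2; 3] 31; term 4 [:: 0; 5] (-9);
         term 4 [:: 2; 4] 108; term 5 [:: 2; 5] 9];
      [:: term 0 [:: 0; 1] (-1); term 2 [:: 1; 2] 1; term 3 [:: 1; 3] 2;
         term 4 [:: 1; 4] 3; term 5 [:: 1; 5] 3];
      [:: term 4 [:: 1; 2] 1];
      [:: term 1 [:: 0; 4] 1];
      [:: term 1 [:: 0; 2] 11; term 2 [:: 0; 3] 14; term 3 [:: 0; 4] 9;
         term 5 [:: 3; 4] 8];
      [:: term 1 [:: 0; 1] 1; term 2 [:: 0; 2] 1; term 3 [:: 0; 3] 1;
         term 4 [:: 0; 4] 1; term 5 [:: 0; 5] 2]]
  | 3 => [::
      [:: term 0 [:: 0; 2; 5] (-18); term 0 [:: 1; 3; 4] (-9);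
         term 1 [:: 1; 2; 5] 60; term 2 [:: 1; 3; 5] 21;
         term 3 [:: 1; 4; 5] 10; term 3 [:: 2; 3; 5] 12;
         term 4 [:: 2; 4; 5] 30];
      [:: term 0 [:: 1; 2; 3] 13; term 3 [:: 1; 2; 5] 6; term 4 [:: 1; 3; 5] 9];
      [:: term 4 [:: 1; 2; 5] 1];
      [:: term 0 [:: 0; 3; 4] (-217); term 1 [:: 0; 2; 5] 124;
         term 1 [:: 1; 3; 4] 62; term 2 [:: 0; 3; 5] 183;
         term 2 [:: 2; 3; 4] 28; term 3 [:: 0; 4; 5] 126;
         term 5 [:: 3; 4; 5] 127];
      [:: term 0 [:: 0; 1; 2] (-3); term 3 [:: 1; 2; 3] (-3);
         term 4 [:: 0; 1; 5] 1; term 4 [:: 1; 2; 4] (-5);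
         term 5 [:: 1; 2; 5] (-4)];
      [:: term 1 [:: 0; 3; 4] 1];
      [:: term 1 [:: 0; 2; 4] 1; term 2 [:: 0; 3; 4] 2];
      [:: term 1 [:: 0; 1; 4] 28; term 1 [:: 0; 2; 3] (-3);
         term 2 [:: 0; 2; 4] 19; term 3 [:: 0; 3; 4] 19;
         term 5 [:: 0; 4; 5] (-37)]]
  | 4 => [::
      [:: term 0 [:: 1; 2; 3; 5] 1];
      [:: term 0 [:: 0; 1; 3; 5] (-4); term 0 [:: 1; 2; 3; 4] 35;
         term 2 [:: 1; 2; 3; 5] (-31); term 3 [:: 1; 2; 4; 5] (-18);
         term 4 [:: 1; 3; 4; 5] (-27)];
      [:: term 0 [:: 0; 1; 2; 5] 1; term 3 [:: 1; 2; 3; 5] 1;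
         term 4 [:: 1; 2; 4; 5] 2];
      [:: term 1 [:: 0; 3; 4; 5] 1];
      [:: term 1 [:: 0; 2; 4; 5] 1; term 2 [:: 0; 3; 4; 5] 2];
      [:: term 0 [:: 0; 2; 3; 4] 11; term 1 [:: 0; 1; 3; 5] (-4);
         term 1 [:: 1; 2; 3; 4] (-4); term 2 [:: 0; 2; 3; 5] (-7);
         term 3 [:: 0; 2; 4; 5] (-9); term 4 [:: 0; 3; 4; 5] (-5);
         term 5 [:: 2; 3; 4; 5] 1];
      [:: term 1 [:: 0; 1; 3; 4] 1; term 2 [:: 0; 2; 3; 4] 1;
         term 5 [:: 0; 3; 4; 5] 1]]
  | 5 => [::
      [:: term 0 [:: 1; 2; 3; 4; 5] 1];
      [:: term 0 [:: 0; 2; 3; 4; 5] (-1); term 1 [:: 1; 2; 3; 4; 5] 1];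
      [:: term 0 [:: 0; 1; 2; 3; 5] 1; term 4 [:: 1; 2; 3; 4; 5] (-1)];
      [:: term 1 [:: 0; 2; 3; 4; 5] 1];
      [:: term 1 [:: 0; 1; 3; 4; 5] 1; term 2 [:: 0; 2; 3; 4; 5] 1]]
  | 6 => [::
      [:: term 0 [:: 0; 1; 2; 3; 4; 5] 1];
      [:: term 1 [:: 0; 1; 2; 3; 4; 5] 1]]
  | _ => [::]
  end.

(** Every h^k_i is closed and homogeneous of degree k. *)
Definition cocycle_check : bool :=
  all (fun k => all (fun v =>
    nilp (dvec v) && all (fun t => count id (legs t.1) == k) v) (hvec k))
  (iota 0 7).

Lemma cocycle_check_true : cocycle_check.
Proof. by vm_cast_no_check (erefl true). Qed.

Section Reflect.
Variable K : fieldType.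
Local Notation sem := (vec_cochain K).

(** The following definitions rebuild a cochain from a sparse vector in exactly
the shape in which sums are written by hand: left-nested, without coefficients
1, and with subtractions for negative coefficients.  With that shape, the list
of cocycles is recovered by conversion alone. *)
Definition pterm (p : positive) (x : monom) : cochain K :=
  if p is xH then monom_cochain K x else (Pos.to_nat p)%:R *: monom_cochain K x.

Definition head_term (t : monom * Z) : cochain K :=
  match t.2 with
  | Z0 => 0
  | Zpos p => pterm p t.1
  | Zneg xH => - monom_cochain K t.1
  | Zneg p => (- (Pos.to_nat p)%:R) *: monom_cochain K t.1
  end.

Definition add_term (c : cochain K) (t : monom * Z) : cochain K :=
  match t.2 with
  | Z0 => c
  | Zpos p => c + pterm p t.1
  | Zneg p => c - pterm p t.1
  end.

Definition written_sum (v : vec) : cochain K :=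
  if v is t :: v' then foldl add_term (head_term t) v' else 0.

Lemma written_sumE v : written_sum v = sem v.
Proof.
have ptermE p x : pterm p x = ofZ K (Zpos p) *: monom_cochain K x.
  by case: p => [p|p|]; rewrite /ofZ -?pmulrn ?scale1r.
have zrneg p : ofZ K (Zneg p) = - ofZ K (Zpos p) by rewrite -ofZN.
have headE t : head_term t = ofZ K t.2 *: monom_cochain K t.1.
  case: t => x [|p|p]; rewrite /head_term ?scale0r ?ptermE //=.
  rewrite zrneg scaleNr -ptermE.
  by case: p => *; rewrite /pterm ?scaleNr.
have addE c t : add_term c t = c + ofZ K t.2 *: monom_cochain K t.1.
  case: t => x [|p|p]; rewrite /add_term /= ?scale0r ?addr0 ?ptermE //.
  by rewrite zrneg scaleNr.
case: v => [|t v]; first by rewrite sem_nil.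
rewrite /= headE sem_cons; elim: v (_ *: _) => [|u v IHv] c /=.
  by rewrite sem_nil addr0.
by rewrite IHv addE sem_cons addrA.
Qed.

Lemma hs_sem k : hs K k = [seq sem v | v <- hvec k].
Proof.
rewrite -(eq_map written_sumE).
by case: k => [|[|[|[|[|[|[|k]]]]]]].
Qed.
End Reflect.

(** * A basis of the cohomology *)

Definition degmons (k : nat) : seq monom :=
  [seq x <- mons | count id (legs x) == k].

(** Greedy choice: a monomial of degree k is kept if its differential is not in
the span of the differentials of those kept before.  That the outcome is a good
choice is established by basis_check. *)
Definition pivots (k : nat) : seq vec :=
  (foldl (fun Eu x =>
     let u := reduce Eu.1 (dvec (vec1 x)) in
     if nilp u then Eu else (rcons Eu.1 u, rcons Eu.2 (vec1 x)))
   ([::], [::]) (degmons k)).2.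

Definition coboundaries : seq vec :=
  flatten [seq [seq dvec u | u <- pivots k] | k <- iota 0 7].

Definition family (k : nat) : seq vec :=
  hvec k ++ (if k is k'.+1 then [seq dvec u | u <- pivots k'] else [::])
    ++ pivots k.

(** In each degree the family spans all monomials, and its total size is the
dimension of the space of cochains. *)
Definition basis_check : bool :=
  all (fun k => spanb (family k) [seq vec1 x | x <- degmons k]) (iota 0 7)
  && (sumn [seq size (hvec k) + (size (pivots k)).*2 | k <- iota 0 7]
        == 6 * 64)%N.

Lemma basis_check_true : basis_check.
Proof. by vm_cast_no_check (erefl true). Qed.

Section Cohomology.
Variable K : fieldType.
Hypothesis charK : [pchar K] =i pred0.
Local Notation sem := (vec_cochain K).
Local Notation d := (dCE K).
Local Notation cls := (cls K).

Definition pivot_cochains (k : nat) : seq (cochain K) :=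
  [seq sem u | u <- pivots k].

Definition all_hs : seq (cochain K) :=
  flatten [seq hs K k | k <- iota 0 7].

Definition all_pivots : seq (cochain K) :=
  flatten [seq pivot_cochains k | k <- iota 0 7].

Lemma hs_sub k : (k < 7)%N -> {subset hs K k <= all_hs}.
Proof. by move=> ltk c ck; apply/flatten_mapP; exists k; rewrite ?mem_iota. Qed.

Lemma piv_sub k : (k < 7)%N -> {subset pivot_cochains k <= all_pivots}.
Proof. by move=> ltk c ck; apply/flatten_mapP; exists k; rewrite ?mem_iota. Qed.

Lemma size_supp m : size m = 6%N -> size (supp m) = count id m.
Proof. by move=> szm; rewrite size_mask. Qed.

Lemma hs_cocycles k : {subset hs K k <= cocycles K k}.
Proof.
have [ltk c|lek] := ltnP k 7; last first.
  by rewrite /hs; do 7!case: k lek => // k lek.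
rewrite hs_sem => /mapP[v vk ->]; have /allP/(_ k) := cocycle_check_true.
rewrite mem_iota ltk => /(_ isT)/allP/(_ v vk)/andP[/nilP dv0 /allP degv].
rewrite memv_cap memv_ker -sem_dvec dv0 sem_nil eqxx /=.
rewrite /vec_cochain big_seq memv_suml // => t /degv/eqP degt; apply: memvZ.
rewrite /monom_cochain; case: ifP => [/andP[_ /eqP szt]|]; last first.
  by rewrite mem0v.
by rewrite -degt -size_supp // mono_Cdeg.
Qed.

Lemma all_hs_cocycle : {subset all_hs <= allcocycles K}.
Proof.
move=> c /flatten_mapP[k]; rewrite mem_iota => ltk /hs_cocycles.
apply: subvP; exact: (sumv_sup (Ordinal (ltk : (k < 7)%N)) isT (subvv _)).
Qed.

Definition family_cochains (k : nat) : seq (cochain K) :=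
  hs K k ++ (if k is k'.+1 then map d (pivot_cochains k') else [::])
    ++ pivot_cochains k.

Lemma sem_family k : [seq sem u | u <- family k] = family_cochains k.
Proof.
rewrite /family /family_cochains !map_cat hs_sem; case: k => [|k] //.
rewrite -map_comp -[map d _]map_comp; congr (_ ++ (_ ++ _)).
by apply: eq_map => u; rewrite /= sem_dvec.
Qed.

Lemma size_families :
  (size all_hs + (size all_pivots).*2)%N
    = sumn [seq size (hvec k) + (size (pivots k)).*2 | k <- iota 0 7]%N.
Proof.
rewrite /all_hs /all_pivots !size_flatten /shape -!map_comp.
elim: (iota 0 7) => //= k r <-; rewrite hs_sem !size_map doubleD.
by rewrite !addnA; congr addn; rewrite addnAC.
Qed.

(* Keeps unification from unfolding the explicit lists and linear maps. *)
Local Opaque hvec pivots mons degmons all_hs all_pivots pivot_cochains.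
Local Opaque hs vec_cochain dCE.

Lemma size_supp_lt m : (size (supp m) < 7)%N.
Proof.
have /leq_trans : (size (supp m) <= size roots)%N.
  by rewrite size_subseq ?mask_subseq.
exact.
Qed.

Lemma Cdeg_span k c : (k < 7)%N ->
  c \in Cdeg K k -> c \in <<family_cochains k>>%VS.
Proof.
rewrite -sem_family => ltk; elim/Cdeg_ind => [|z u v uF vF|a m lta szm szk].
- exact: mem0v.
- by rewrite memvD ?memvZ.
have /andP[/allP/(_ k) + _] := basis_check_true.
rewrite mem_iota ltk => /(_ isT)/(spanbP charK)/(_ (vec1 (Mon a m))).
rewrite sem1 sem_monom_mono //; apply; apply: map_f.
by rewrite mem_filter mem_mons lta szm -size_supp // szk eqxx.
Qed.

Lemma family_sub k : (k < 7)%N ->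
  (<<family_cochains k>> <= <<all_hs ++ map d all_pivots ++ all_pivots>>)%VS.
Proof.
move=> ltk; rewrite /family_cochains (span_cat (hs K k)).
rewrite (span_cat _ (pivot_cochains k)) (span_cat all_hs).
rewrite (span_cat (map d all_pivots)).
apply: addvS; first exact/sub_span/hs_sub.
apply: addvS; last exact/sub_span/piv_sub.
case: k ltk => [|k] ltk; first by rewrite span_nil sub0v.
by rewrite -!limg_span; apply/limgS/sub_span/piv_sub/ltnW.
Qed.

Lemma family_full : (<<all_hs ++ map d all_pivots ++ all_pivots>> = fullv)%VS.
Proof.
apply/vspaceP=> c; rewrite memvf.
elim/cochain_ind: c => [|z u v uF vF|a m lta szm].
- exact: mem0v.
- by rewrite memvD ?memvZ.
apply: (subvP (family_sub (size_supp_lt m))).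
by apply: (Cdeg_span (size_supp_lt m)); apply: mono_Cdeg.
Qed.

Lemma dim_cochain : \dim {:cochain K} = (64 * 6)%N.
Proof.
have -> : \dim {:cochain K} = (#|{set 'I_6}| * (1 * 6))%N by rewrite dimvf.
by rewrite mul1n -cardsT -powersetT card_powerset cardsT card_ord.
Qed.

Lemma size_family : (size all_hs + (size all_pivots).*2)%N = \dim {:cochain K}.
Proof.
have /andP[_ /eqP szF] := basis_check_true.
by rewrite dim_cochain size_families szF.
Qed.

Lemma all_hs_dCE : {in all_hs, forall c, d c = 0}.
Proof. by move=> c /all_hs_cocycle/allcocycles_dCE. Qed.

Lemma lker_cls : lker cls = limg d.
Proof. exact: lker_piv. Qed.

Lemma cls_dCE c : cls (d c) = 0.
Proof. by apply/eqP; rewrite -memv_ker lker_cls memv_img ?memvf. Qed.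

(** The span of h meets the coboundaries trivially, because h and the
differentials of the pivots are part of a basis. *)
Lemma free_cls : free (map cls all_hs).
Proof.
have capH : (<<all_hs>> :&: lker cls = 0)%VS.
  rewrite lker_cls.
  exact: (split_cap all_hs_dCE (@dCE_dCE K) family_full size_family).
have basisH : basis_of <<all_hs>>%VS all_hs.
  rewrite basisEfree (split_free_classes family_full size_family) subvv.
  exact: dim_span.
exact: basis_free (limg_basis_of capH basisH).
Qed.

(** A cocycle z of degree k is h + d c + u with h in the span of the h^k_i and u
in the span of the pivots; d z = d u = 0 forces u = 0. *)
Lemma Hcoh_span k : Hcoh K k = <<map cls (hs K k)>>%VS.
Proof.
apply: subv_anti; apply/andP; split; last first.
  by rewrite -limg_span limgS //; apply/span_subvP/hs_cocycles.
apply/subvP=> _ /memv_imgP[z zZ ->]; move: zZ; rewrite memv_cap memv_ker.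
case/andP=> /eqP dz0 zk; have [ltk|lek] := ltnP k 7; last first.
  suff -> : z = 0 by rewrite linear0 mem0v.
  elim/Cdeg_ind: zk {dz0} => // [c u v -> ->|a m _ _ szm].
    by rewrite scaler0 addr0.
  by have := leq_trans (size_supp_lt m) lek; rewrite szm ltnn.
have := Cdeg_span ltk zk; rewrite /family_cochains (span_cat (hs K k)).
rewrite (span_cat _ (pivot_cochains k)).
case/memv_addP=> h hH [_ /memv_addP[b bB [u uU ->]] defz].
have [c defb] : exists c, b = d c.
  case: (k) bB => [|k'].
    by rewrite span_nil memv0 => /eqP->; exists 0; rewrite linear0.
  by rewrite -limg_span => /memv_imgP[c _ ->]; exists c.
have dh0 : d h = 0.
  apply: allcocycles_dCE; apply: subvP hH; apply/span_subvP=> x /(hs_sub ltk).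
  exact: all_hs_cocycle.
have u0 : u = 0.
  apply: (split_ker family_full size_family).
    by apply: subvP uU; apply/sub_span/piv_sub.
  by move: dz0; rewrite defz defb !linearD /= dh0 dCE_dCE !add0r.
rewrite defz u0 addr0 linearD defb /= cls_dCE addr0 -limg_span.
exact: memv_img.
Qed.

End Cohomology.

(** * The derived series *)

(** The vector of h^k_i for p = (k, i), with i starting at 1. *)
Definition hvec_at (p : nat * nat) : vec := nth [::] (hvec p.1) p.2.-1.

Definition row_index (k : nat) : seq (nat * nat) :=
  [seq (k, i) | i <- iota 1 (size (hvec k))].

(** The index sets of the generators of the successive terms of the derived
series. *)
Definition index0 : seq (nat * nat) :=
  flatten [seq row_index k | k <- iota 0 7].

Definition index1 : seq (nat * nat) :=
  row_index 0 ++ [:: (1, 3); (1, 4)] ++ row_index 2 ++ row_index 3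
  ++ row_index 4 ++ row_index 5 ++ row_index 6.

Definition index2 : seq (nat * nat) :=
  [:: (1, 3); (1, 4); (2, 2); (2, 4); (2, 6);
      (3, 2); (3, 3); (3, 5); (3, 6); (3, 7); (3, 8);
      (4, 2); (4, 3); (4, 5); (4, 6); (4, 7);
      (5, 2); (5, 3); (5, 4); (5, 5); (6, 1); (6, 2)].

Definition index3 : seq (nat * nat) := [:: (2, 4); (6, 2)].

(** Modulo coboundaries, the brackets of the h_p for p in I and the h_p for p in
J span the same space. *)
Definition derived_check (I J : seq (nat * nat)) : bool :=
  let X := [seq hvec_at p | p <- I] in
  let Y := [seq hvec_at p | p <- J] in
  let D := [seq brvec 1 x y [::] | x <- X, y <- X] in
  spanb (coboundaries ++ Y) D && spanb (coboundaries ++ D) Y.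

Lemma derived_check_true :
  [&& derived_check index0 index1, derived_check index1 index2,
      derived_check index2 index3 & derived_check index3 [::]].
Proof. by vm_cast_no_check (erefl true). Qed.

Section DerivedSeries.
Variable K : fieldType.
Hypothesis charK : [pchar K] =i pred0.
Local Notation sem := (vec_cochain K).
Local Notation cls := (cls K).

(** By bilinearity, the spanning vectors used to form the bracket of two
subspaces are immaterial. *)
Lemma Hbrv_span (X Y : seq (cohom K)) :
  Hbrv <<X>> <<Y>> = <<[seq Hbr x y | x <- X, y <- Y]>>%VS.
Proof.
have Hbr0l y : Hbr 0 y = 0 :> cohom K.
  by have := Hbr_linear_l y (-1) 0 0; rewrite scaler0 addr0 scaleN1r addNr.
have Hbr0r x : Hbr x 0 = 0 :> cohom K.
  by have := Hbr_linear_r x (-1) 0 0; rewrite scaler0 addr0 scaleN1r addNr.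
apply: subv_anti; apply/andP; split; last first.
  apply/span_subvP=> _ /allpairsP[[x y] /= [xX yY ->]].
  by apply: memv_Hbrv; apply: memv_span.
apply/span_subvP=> _ /allpairsP[[x y] /= [/vbasis_mem xX /vbasis_mem yY ->]].
elim/span_ind: xX => {x} [|z u v IHu IHv|x xX].
- by rewrite Hbr0l mem0v.
- by rewrite Hbr_linear_l memvD ?memvZ.
elim/span_ind: yY => {y} [|z u v IHu IHv|y yY].
- by rewrite Hbr0r mem0v.
- by rewrite Hbr_linear_r memvD ?memvZ.
by rewrite memv_span //; apply: allpairs_f.
Qed.

Lemma index_sub :
  [/\ subseq index1 index0, subseq index2 index0, subseq index3 index0
    & subseq [:: (1, 3); (1, 4)]%N index0].
Proof. by []. Qed.

Lemma hclsE k i : hcls K k i = cls (sem (hvec_at (k, i))).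
Proof.
rewrite /hcls hs_sem /hvec_at /=; congr (cls _); move: (hvec k) i.-1 => s n.
by elim: s n => [|v s IHs] [|n] //=; rewrite sem_nil.
Qed.

Lemma hvec_at_cocycle p : sem (hvec_at p) \in allcocycles K.
Proof.
case: p => k i; have [lti|lei] := ltnP i.-1 (size (hvec k)); last first.
  by rewrite /hvec_at nth_default // sem_nil mem0v.
apply: (@all_hs_cocycle K); have ltk : (k < 7)%N.
  rewrite ltnNge; apply/negP=> lek; move: lti; rewrite /hvec.
  by do 7!case: k lek => // k lek.
apply: (hs_sub ltk); rewrite hs_sem; apply: map_f; exact: mem_nth.
Qed.

Definition hspan (I : seq (nat * nat)) : seq (cochain K) :=
  [seq sem (hvec_at p) | p <- I].

Lemma Span_cls I : Span K I = <<map cls (hspan I)>>%VS.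
Proof.
rewrite /Span -map_comp; congr <<_>>%VS; apply: eq_map => -[k i] /=.
exact: hclsE.
Qed.

Lemma spanb_cls (X Y : seq vec) : spanb (coboundaries ++ X) Y ->
  (<<[seq cls (sem v) | v <- Y]>> <= <<[seq cls (sem v) | v <- X]>>)%VS.
Proof.
move=> spanY; apply/span_subvP=> _ /mapP[v vY ->].
have := spanbP charK spanY vY; rewrite map_cat span_cat.
case/memv_addP=> b bB [x xX ->].
rewrite linearD /=; have -> : cls b = 0.
  apply/eqP; rewrite -memv_ker lker_cls; apply: subvP bB.
  apply/span_subvP=> _ /mapP[u /flatten_mapP[k _ /mapP[w _ ->]] ->].
  by rewrite sem_dvec memv_img ?memvf.
by rewrite add0r (map_comp cls) -limg_span memv_img.
Qed.

Lemma Hbrv_Span I J :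
  derived_check I J -> Hbrv (Span K I) (Span K I) = Span K J.
Proof.
move=> /andP[/spanb_cls DY /spanb_cls YD]; rewrite !Span_cls Hbrv_span.
have -> : [seq Hbr x y | x <- map cls (hspan I), y <- map cls (hspan I)]
    = [seq cls (sem v) | v <- [seq brvec 1 x y [::]
        | x <- map hvec_at I, y <- map hvec_at I]].
  rewrite /hspan map_allpairs !allpairs_mapl !allpairs_mapr.
  apply: eq_allpairs => p q.
  rewrite /= Hbr_cls ?hvec_at_cocycle //.
  by rewrite sem_brvec sem_nil addr0 ofZ1 scale1r.
have -> : map cls (hspan J) = [seq cls (sem v) | v <- map hvec_at J].
  by rewrite -[RHS]map_comp -[LHS]map_comp.
by apply: subv_anti; rewrite DY YD.
Qed.

Definition hcls_at (p : nat * nat) : cohom K := hcls K p.1 p.2.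

Lemma cls_hs k : map cls (hs K k) = map hcls_at (row_index k).
Proof.
have szhs : size (hs K k) = size (hvec k) by rewrite hs_sem size_map.
apply: (@eq_from_nth _ 0) => [|i]; first by rewrite !size_map size_iota szhs.
rewrite size_map => lti; rewrite (nth_map 0) // (nth_map (0, 0)%N); last first.
  by rewrite size_map size_iota -szhs.
by rewrite (nth_map 0%N) ?size_iota -?szhs // nth_iota -?szhs.
Qed.

Lemma cls_all_hs : map cls (all_hs K) = map hcls_at index0.
Proof.
have eq_hs : map cls \o hs K =1 map hcls_at \o row_index.
  by move=> k; apply: cls_hs.
by rewrite /all_hs /index0 !map_flatten -!map_comp (eq_map eq_hs).
Qed.

Lemma free_hcls_at I : subseq I index0 -> free (map hcls_at I).
Proof.
move=> sI; apply: (subseq_free (map_subseq hcls_at sI)).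
by rewrite -cls_all_hs free_cls.
Qed.

Lemma dim_Span I : subseq I index0 -> \dim (Span K I) = size I.
Proof. by move=> /free_hcls_at/eqP->; rewrite size_map. Qed.

Lemma Hcoh_Span k : Hcoh K k = Span K (row_index k).
Proof. by rewrite Hcoh_span // cls_hs. Qed.

Lemma row_index_sub k : subseq (row_index k) index0.
Proof. by do 7![case: k => [|k] //]; rewrite sub0seq. Qed.

Lemma lalg_Span : lalg K = Span K index0.
Proof.
rewrite /lalg -(big_mkord xpredT (Hcoh K)) /index_iota subn0 /Span /index0.
elim: (iota 0 7) => [|k r IHr] /=; first by rewrite big_nil span_nil.
by rewrite big_cons IHr Hcoh_Span map_cat span_cat.
Qed.

(** index1 lists the generators in the order of the summands. *)
Lemma Span_index1 : Span K index1 =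
  (Hcoh K 0 + Span K [:: (1, 3); (1, 4)]%N + Hcoh K 2 + Hcoh K 3 + Hcoh K 4
   + Hcoh K 5 + Hcoh K 6)%VS.
Proof. by rewrite !Hcoh_Span /Span /index1 !map_cat !span_cat !addvA. Qed.

Lemma Span_nil : Span K [::] = 0%VS.
Proof. exact: span_nil. Qed.

Lemma Hbrv0 : Hbrv 0 0 = 0%VS :> {vspace cohom K}.
Proof. by rewrite -span_nil Hbrv_span. Qed.

Lemma basis_Span I : subseq I index0 -> basis_of (Span K I) (map hcls_at I).
Proof.
by move=> sI; apply/andP; split; [apply: eqxx | apply: free_hcls_at].
Qed.

End DerivedSeries.

(** The derived series follows by applying Hbrv_Span three times, and once more
to reach 0; its terms before are nonzero because the h are independent. *)
Theorem cohomology_char0 (K : fieldType) (charK : [pchar K] =i pred0) :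
  [/\ (forall k : nat, {subset hs K k <= cocycles K k}),
      (forall k : nat, basis_of (Hcoh K k) [seq cls K c | c <- hs K k]),
      basis_of (lalg K)
        [seq cls K c | c <- flatten [seq hs K k | k <- iota 0 7]],
      (exists i : nat, derived_series K i = 0%VS)
    & [/\ forall i : nat, (derived_series K i != 0%VS) = (i < 4)%N,
          derived_series K 0 = lalg K,
          derived_series K 1 =
            (Hcoh K 0 + Span K [:: (1, 3); (1, 4)]%N + Hcoh K 2
             + Hcoh K 3 + Hcoh K 4 + Hcoh K 5 + Hcoh K 6)%VS
          /\ directv
            (Hcoh K 0 + Span K [:: (1, 3); (1, 4)]%N + Hcoh K 2
             + Hcoh K 3 + Hcoh K 4 + Hcoh K 5 + Hcoh K 6)%VS,
          derived_series K 2 = Span K index2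
        & derived_series K 3 = Span K index3]].
Proof.
have /and4P[d01 d12 d23 d34] := derived_check_true.
have dS i :
  derived_series K i.+1 = Hbrv (derived_series K i) (derived_series K i) by [].
have D0 : derived_series K 0 = Span K index0 by apply: lalg_Span.
have D1 : derived_series K 1 = Span K index1.
  by rewrite dS D0 (Hbrv_Span charK d01).
have D2 : derived_series K 2 = Span K index2.
  by rewrite dS D1 (Hbrv_Span charK d12).
have D3 : derived_series K 3 = Span K index3.
  by rewrite dS D2 (Hbrv_Span charK d23).
have D4 i : derived_series K (i + 4) = 0%VS.
  elim: i => [|i IHi]; last by rewrite addSn dS IHi Hbrv0.
  by rewrite add0n dS D3 (Hbrv_Span charK d34) Span_nil.
(* Conversion would evaluate the checks whenever it meets them. *)
move=> {d01 d12 d23 d34}; split.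
- exact: hs_cocycles.
- move=> k; rewrite (Hcoh_Span charK) cls_hs.
  exact: (basis_Span charK (row_index_sub k)).
- rewrite (lalg_Span charK) -/(all_hs K) cls_all_hs.
  exact: (basis_Span charK (subseq_refl index0)).
- by exists 4%N; apply: (D4 0%N).
have [sub1 sub2 sub3 sub13] := index_sub.
split; [|exact: erefl| |exact: D2|exact: D3].
- have Sn0 I : subseq I index0 -> (0 < size I)%N -> Span K I != 0%VS.
    by move=> sI nI; rewrite -dimv_eq0 (dim_Span charK sI) -lt0n.
  move=> [|[|[|[|i]]]].
  + by rewrite D0 (Sn0 _ (subseq_refl _)).
  + by rewrite D1 (Sn0 _ sub1).
  + by rewrite D2 (Sn0 _ sub2).
  + by rewrite D3 (Sn0 _ sub3).
  by have := D4 i; rewrite addn4 => ->; rewrite eqxx.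
split; first by rewrite D1 Span_index1.
rewrite directvE /= -(Span_index1 charK) !(Hcoh_Span charK).
rewrite (dim_Span charK sub1) (dim_Span charK sub13).
rewrite (dim_Span charK (row_index_sub 0)).
rewrite (dim_Span charK (row_index_sub 2)) (dim_Span charK (row_index_sub 3)).
rewrite (dim_Span charK (row_index_sub 4)) (dim_Span charK (row_index_sub 5)).
by rewrite (dim_Span charK (row_index_sub 6)).
Qed.

Theorem mainTheorem6 (R : realType) :
  [/\ (forall k : nat, {subset hs R[i] k <= cocycles R[i] k}),
      (forall k : nat, basis_of (Hcoh R[i] k)
                           [seq cls R[i] c | c <- hs R[i] k]),
      basis_of (lalg R[i])
        [seq cls R[i] c | c <- flatten [seq hs R[i] k | k <- iota 0 7]],
      (exists i : nat, derived_series R[i] i = 0%VS)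
    & [/\ forall i : nat, (derived_series R[i] i != 0%VS) = (i < 4)%N,
          derived_series R[i] 0 = lalg R[i],
          derived_series R[i] 1 =
            (Hcoh R[i] 0 + Span R[i] [:: (1, 3); (1, 4)]%N + Hcoh R[i] 2
             + Hcoh R[i] 3 + Hcoh R[i] 4 + Hcoh R[i] 5 + Hcoh R[i] 6)%VS
          /\ directv
            (Hcoh R[i] 0 + Span R[i] [:: (1, 3); (1, 4)]%N + Hcoh R[i] 2
             + Hcoh R[i] 3 + Hcoh R[i] 4 + Hcoh R[i] 5 + Hcoh R[i] 6)%VS,
          derived_series R[i] 2 =
            Span R[i] [:: (1, 3); (1, 4);
                          (2, 2); (2, 4); (2, 6);
                          (3, 2); (3, 3); (3, 5); (3, 6); (3, 7); (3, 8);
                          (4, 2); (4, 3); (4, 5); (4, 6); (4, 7);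
                          (5, 2); (5, 3); (5, 4); (5, 5);
                          (6, 1); (6, 2)]%N
        & derived_series R[i] 3 = Span R[i] [:: (2, 4); (6, 2)]%N]].
Proof. exact: (cohomology_char0 (@Num.Theory.pchar_num R[i])). Qed.
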